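(* Let $n\in\{4,5,6,7\}$ and let $\mathbf{e}=(e_1,\ldots,e_n)\in\mathbb{Z}^n$ with $e_1\cdots e_n\neq 0$. For every $\varepsilon>0$ there is a constant $C=C(n,\mathbf{e},\varepsilon)>0$ such that the following holds. For any prime $p$, any positive integer $h\le p$, any integers $k_1,\ldots,k_n$ with corresponding cube $\mathcal{B}=[k_1+1,k_1+h]\times\cdots\times[k_n+1,k_n+h]$, any complex-valued weights $\boldsymbol{\rho}=(\rho_1,\ldots,\rho_n)$ with $|\rho_j(x)|\le 1$ for all $x\in\mathbb{R}$ and $j=1,\ldots,n$, and any integer $\lambda$ with $\gcd(\lambda,p)=1$, we have $$ |S_p(\lambda,\boldsymbol{\rho},\mathbf{e};\mathcal{B})|\le C\,h^{\varepsilon}\cdot \begin{cases} h^{2}p^{1/2}+h^{4}p^{-1/2} & \text{if } n=4,\\ h^{5/2}p^{1/2}+h^{4}p^{1/8}+h^{5}p^{-3/8} & \text{if } n=5,\\ h^{3}p^{1/2}+h^{6}p^{-1/4} & \text{if } n=6,\\ h^{11/2}p^{1/4}+h^{7}p^{-1/8} & \text{if } n=7. \end{cases} $$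
   Context: For a prime $p$ write $\mathbf{e}_p(z)=\exp(2\pi i z/p)$. The sum is $$ S_p(\lambda,\boldsymbol{\rho},\mathbf{e};\mathcal{B})=\sum_{\substack{(x_1,\ldots,x_n)\in\mathcal{B}\\ x_1\cdots x_n\not\equiv 0 \pmod p}}\rho_1(x_1)\cdots\rho_n(x_n)\,\mathbf{e}_p(\lambda x_1^{e_1}\cdots x_n^{e_n}), $$ where the summation is over integer vectors $(x_1,\ldots,x_n)$ in $\mathcal{B}$, and for a negative exponent $e$ the power $x^e$ is computed with the inverse of $x$ modulo $p$ (so $x_1^{e_1}\cdots x_n^{e_n}$ is a residue class modulo $p$). *)

(* Defs.v *)
From mathcomp Require Import all_boot all_order all_algebra.
From mathcomp Require Import all_classical all_reals all_analysis.
From mathcomp Require Import complex.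

Set Implicit Arguments.
Unset Strict Implicit.
Unset Printing Implicit Defensive.

Import Order.TTheory GRing.Theory Num.Theory.

Local Open Scope ring_scope.
Local Open Scope complex_scope.

(* e_p(z) = exp(2 pi i z / p), through Euler's formula. *)
Definition ep (R : realType) (p : nat) (z : int) : R[i] :=
  let t : R := 2 * pi * z%:~R / p%:R in cos t +i* sin t.

(* The residue class modulo the prime p of lambda x_1^{e_1} ... x_n^{e_n}:
   [^] is the integer power of the field 'F_p, so that a negative exponent
   inverts x_j modulo p. *)
Definition monomial_mod (p n : nat) (lambda : int) (e x : 'I_n -> int) : 'F_p :=
  lambda%:~R * \prod_(j < n) (x j)%:~R ^ e j.

(* The cube [k_1 + 1, k_1 + h] x ... x [k_n + 1, k_n + h] has the integer points
   x_j = k_j + 1 + i_j, with i ranging over the functions 'I_n -> 'I_h. *)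
Definition cube_point (n h : nat) (k : 'I_n -> int) (i : {ffun 'I_n -> 'I_h}) :
    'I_n -> int :=
  fun j => k j + 1 + (i j : nat)%:Z.

(* A residue class is given to e_p through its representative in {0, ..., p-1};
   e_p is p-periodic on the integers, so the choice is immaterial. *)
Definition weighted_sum (R : realType) (p n h : nat) (lambda : int)
    (rho : 'I_n -> R -> R[i]) (e k : 'I_n -> int) : R[i] :=
  \sum_(i : {ffun 'I_n -> 'I_h} |
          ~~ (p%:Z %| (\prod_(j < n) cube_point k i j)%R)%Z)
     (\prod_(j < n) rho j (cube_point k i j)%:~R) *
     ep R p (monomial_mod p lambda e (cube_point k i) : nat)%:Z.

(* Meaningful for n = 4, 5, 6, 7 only; the default value is irrelevant. *)
Definition sum_bound (R : realType) (n h p : nat) : R :=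
  let H : R := h%:R in
  let P : R := p%:R in
  match n with
  | 4 => H `^ 2 * P `^ (1 / 2) + H `^ 4 * P `^ (- (1 / 2))
  | 5 => H `^ (5 / 2) * P `^ (1 / 2) + H `^ 4 * P `^ (1 / 8)
         + H `^ 5 * P `^ (- (3 / 8))
  | 6 => H `^ 3 * P `^ (1 / 2) + H `^ 6 * P `^ (- (1 / 4))
  | 7 => H `^ (11 / 2) * P `^ (1 / 4) + H `^ 7 * P `^ (- (1 / 8))
  | _ => 0
  end.

(* Main.v *)
Require Import Defs.
From mathcomp Require Import all_boot all_order all_algebra.
From mathcomp Require Import all_classical all_reals all_analysis.
From mathcomp Require Import complex.
From mathcomp Require Import zify ring lra.

Set Implicit Arguments.
Unset Strict Implicit.
Unset Printing Implicit Defensive.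

Import Order.TTheory GRing.Theory Num.Theory.

Local Open Scope ring_scope.
Local Open Scope complex_scope.

(** Splitting the variables into two blocks, Cauchy-Schwarz and orthogonality of
    the additive characters of F_p bound the square of the sum by [p] times the
    product of the multiplicative energies of the two blocks. A further
    Cauchy-Schwarz in the multiplicative group reduces these mixed energies to
    those of one interval, the number E_2 (resp. E_3) of solutions of
    x1 x2 = y1 y2 (resp. x1 x2 x3 = y1 y2 y3) in F_p with all variables in
    [s, s + h). It suffices to have E_2 << h^(2+eps) for h << p^(1/2) and
    E_3 << h^(3+eps) for h << p^(1/4); cutting a longer interval into pieces gives
    E_2 << h^eps (h^2 + h^4/p) and E_3 << h^eps (h^3 + h^6 p^(-3/4)).

    For E_2, differences of points of the line x = r y reduce to the centered
    interval, where the congruence u v' = u' v is an equality of integers and the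
    divisor bound applies. For E_3, write a solution as
    x_i = s + a_i, y_i = s + b_i: the quadratic
    P(Z) = prod (Z + a_i) - prod (Z + b_i) = A Z^2 + B Z + C vanishes at [s] modulo [p],
    with A << h, B << h^2, C << h^3. When no a_i equals a b_j, each P arises from at most
    h^(1+eps) solutions, because P(- b_1) = prod (a_i - b_1) is a nonzero integer. If two
    such P share A, then [s] is congruent to a fraction - c / b of small height; then
    either all P vanish at - c / b over the integers and the divisor bound applies
    to prod (b a_i - c) = prod (b b_i - c), or counting lattice points shows that
    there are only O(h^2) quadratics P. *)

(** * Counting with lists of integers *)

(** The counting principle behind most bounds below: [L] lists the possible values of [f] and [m]
    bounds each fiber. Induction on [L] removes the fiber of its head. *)
Lemma size_fibers (T U : eqType) (f : T -> U) (L : seq U) (m : nat) (s : seq T) :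
  (forall x, x \in s -> f x \in L) ->
  (forall u, u \in L -> (size [seq x <- s | f x == u] <= m)%N) ->
  (size s <= size L * m)%N.
Proof.
elim: L s => [|u L IH] s sL sm.
  by case: s sL {sm} => // x s /(_ x); rewrite mem_head in_nil => /(_ isT).
rewrite -(count_predC (fun x => f x == u)) /= mulSn; apply: leq_add.
  by rewrite -size_filter; apply: sm; rewrite mem_head.
rewrite -size_filter; apply: IH => [x|v vL].
  rewrite mem_filter => /andP[/= fxu /sL]; rewrite inE.
  by case/orP => // /eqP fx; rewrite fx eqxx in fxu.
apply: leq_trans (sm v _); last by rewrite inE vL orbT.
rewrite !size_filter count_filter; apply: sub_count => x /= /andP[].
by move=> ->.
Qed.

Lemma size_inj_le (T U : eqType) (f : T -> U) (L : seq U) (s : seq T) :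
  uniq s -> {in s &, injective f} -> (forall x, x \in s -> f x \in L) ->
  (size s <= size L)%N.
Proof.
move=> us fi sL; rewrite -(size_map f); apply: uniq_leq_size.
  by rewrite map_inj_in_uniq.
by move=> _ /mapP[x xs ->]; apply: sL.
Qed.

Definition zball (m : nat) : seq int := [seq i%:Z - m%:Z | i <- iota 0 (2 * m + 1)].

Lemma size_zball m : size (zball m) = (2 * m + 1)%N.
Proof. by rewrite size_map size_iota. Qed.

Lemma mem_zball m (z : int) : (`|z| <= m)%N -> z \in zball m.
Proof.
move=> zm; apply/mapP; exists (absz (z + m%:Z)); last by lia.
by rewrite mem_iota; lia.
Qed.

Definition zdivisors (n : int) : seq int :=
  [seq d%:Z | d <- divisors `|n|%N] ++ [seq - d%:Z | d <- divisors `|n|%N].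

Lemma size_zdivisors n : size (zdivisors n) = (2 * size (divisors `|n|))%N.
Proof. by rewrite size_cat !size_map mul2n addnn. Qed.

Lemma mem_zdivisors (n d : int) : n != 0 -> (exists m, n = m * d) -> d \in zdivisors n.
Proof.
move=> n0 [m nE]; rewrite mem_cat.
have dd : `|d|%N \in divisors `|n|.
  by rewrite -dvdn_divisors ?absz_gt0 // nE abszM dvdn_mull.
have [d0|d0] := leP 0 d; apply/orP; [left|right]; apply/mapP; exists `|d|%N => //; lia.
Qed.

(** Multiples of [p] of size at most [c] are indexed by their quotients, which [zball (c %/ p)]
    lists. *)
Lemma absz_divz_le (q : int) (p c : nat) :
  (0 < p)%N -> (`|q| <= c)%N -> (p%:Z %| q)%Z -> (`|(q %/ p%:Z)%Z|%N <= c %/ p)%N.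
Proof.
move=> p0 qc pq; rewrite leq_divRL //.
have -> : (`|(q %/ p%:Z)%Z|%N * p = `|((q %/ p%:Z)%Z * p%:Z)%R|%N)%N by rewrite abszM.
by rewrite divzK.
Qed.

(** * Integer quadratics with a common root modulo p *)

Definition quad_eval (P : int * int * int) (s : int) : int :=
  P.1.1 * s ^+ 2 + P.1.2 * s + P.2.

(** The box containing the coefficients of [prod (Z + a_i) - prod (Z + b_i)], with three factors in
    each product and offsets in [[0, h)]. *)
Definition quad_small (h : nat) (P : int * int * int) : bool :=
  [&& `|P.1.1| <= 3 * h, `|P.1.2| <= 3 * h ^ 2 & `|P.2| <= h ^ 3]%N.

Lemma zmul_bound (x y : int) (a b : nat) : (`|x| <= a)%N -> (`|y| <= b)%N -> (`|(x * y)%R| <= a * b)%N.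
Proof. by move=> xa yb; rewrite abszM leq_mul. Qed.

Lemma zadd_bound (x y : int) (a b : nat) : (`|x| <= a)%N -> (`|y| <= b)%N -> (`|(x + y)%R| <= a + b)%N.
Proof. lia. Qed.

Lemma zsub_bound (x y : int) (a b : nat) : (`|x| <= a)%N -> (`|y| <= b)%N -> (`|(x - y)%R| <= a + b)%N.
Proof. lia. Qed.

Lemma zadd_bound_inv (x y : int) (a : nat) : (`|(x + y)%R| <= a)%N -> (`|x| <= a + `|y|)%N.
Proof. lia. Qed.

Lemma zdiff_bound (x y : int) (a : nat) :
  (`|(x + y)%R| <= a)%N -> (`|x| <= a)%N -> (`|y| <= 2 * a)%N.
Proof. lia. Qed.

(* The homogenized value of the quadratic at the rational [- c / b]. *)
Definition quad_res (b c : int) (P : int * int * int) : int :=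
  P.1.1 * c ^+ 2 - P.1.2 * b * c + P.2 * b ^+ 2.

(** Modulo [p], [b * s] may be replaced by [- c] in [b ^+ 2 * quad_eval P s]; the explicit cofactor
    of [b * s + c] makes this an identity over the integers. *)
Lemma quad_res_dvd (p : nat) (s b c : int) P :
  (p%:Z %| b * s + c)%Z -> (p%:Z %| quad_eval P s)%Z -> (p%:Z %| quad_res b c P)%Z.
Proof.
move=> bc Ps.
have -> : quad_res b c P = b ^+ 2 * quad_eval P s
   + (b * s + c) * (P.1.1 * (c - b * s) - P.1.2 * b).
  by rewrite /quad_res /quad_eval; ring.
by apply: rpredD; [apply: dvdz_mull|apply: dvdz_mulr].
Qed.

Section CollinearDifferences.
Variables (b c : int).
Hypothesis (b0 : b != 0) (bc : coprimez b c).

Lemma collinear_mult (x y : int) : x * c = b * y -> exists t, x = b * t /\ y = c * t.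
Proof.
move=> xy; have /dvdzP[t xE] : (b %| x)%Z.
  by rewrite -(Gauss_dvdzl _ bc) xy dvdz_mulr.
exists t; split; first by rewrite xE mulrC.
by apply: (mulfI b0); rewrite -xy xE; ring.
Qed.

(** Gauss's lemma: a quadratic vanishing at [- c / b] is divisible over the integers by the
    primitive form [b Z + c], here with cofactor [al Z + ga]. *)
Lemma quad_res_factor P : quad_res b c P = 0 ->
  exists al ga, P = (b * al, c * al + b * ga, c * ga).
Proof.
case: P => [[A B] C]; rewrite /quad_res /= => e0.
have bc2 : coprimez b (c ^+ 2) by rewrite coprimezXr.
have /dvdzP[al AE] : (b %| A)%Z.
  rewrite -(Gauss_dvdzl _ bc2); apply/dvdzP; exists (B * c - C * b).
  by apply/eqP; rewrite -subr_eq0 -e0; apply/eqP; ring.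
have : (al * c - B) * c = b * (- C).
  by apply: (mulfI b0); apply/eqP; rewrite -subr_eq0 -e0 AE; apply/eqP; ring.
move=> /collinear_mult[ga [e1 e2]]; exists al, (- ga).
by congr (_, _, _); [rewrite AE mulrC|rewrite mulrN -e1; ring|rewrite mulrN -e2 opprK].
Qed.
End CollinearDifferences.

(** Here [x] and [y] are the sizes of the coefficients of the cofactor. If [h * b] attains [N], the
    leading coefficient bounds [x] and then the middle one bounds [y]; if [c] does, the constant
    term bounds [y] and then the middle one bounds [x]. *)
Lemma homogeneous_bounds (h N b c x y : nat) : (0 < h)%N ->
  (h * b <= N)%N -> (c <= N)%N -> (N <= h * b)%N || (N <= c)%N ->
  (b * x <= 2 * (3 * h))%N -> (c * y <= 2 * h ^ 3)%N ->
  (b * y <= 2 * (3 * h ^ 2) + c * x)%N -> (c * x <= 2 * (3 * h ^ 2) + b * y)%N ->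
  (x * N <= 8 * h ^ 2)%N && (y * N <= 12 * h ^ 3)%N.
Proof.
move=> h0 hbN cN /orP[Nb|Nc] ba cg bb1 bb2; apply/andP.
  have xN : (x * N <= 6 * h ^ 2)%N.
    apply: leq_trans (leq_mul (leqnn x) Nb) _.
    have := leq_mul (leqnn h) ba; lia.
  split; first by apply: leq_trans xN _; lia.
  apply: leq_trans (leq_mul (leqnn y) Nb) _.
  have e3 := leq_mul (leqnn h) bb1.
  have e5 := leq_mul (leqnn h) (leq_mul cN (leqnn x)).
  have e6 := leq_mul (leqnn h) xN.
  lia.
have yN : (y * N <= 2 * h ^ 3)%N by apply: leq_trans (leq_mul (leqnn y) Nc) _; lia.
split; last by apply: leq_trans yN _; lia.
have e4 : (h * (b * y) <= h * (2 * h ^ 2))%N.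
  have := leq_mul (leqnn y) hbN; lia.
rewrite leq_pmul2l // in e4.
apply: leq_trans (leq_mul (leqnn x) Nc) _; lia.
Qed.

(** Differences from a fixed member [P0] have [quad_res] zero, so they are multiples of [b Z + c];
    the cofactors [(al, ga)] lie in a small box and determine the quadratic. *)
Lemma size_homogeneous (h N : nat) (b c : int) (ss : seq (int * int * int)) :
  (0 < h)%N -> b != 0 -> coprimez b c ->
  (h * `|b| <= N)%N -> (`|c| <= N)%N -> (N <= h * `|b|)%N || (N <= `|c|)%N ->
  uniq ss -> {in ss, forall P, quad_small h P} ->
  {in ss &, forall P P', quad_res b c P = quad_res b c P'} ->
  (size ss <= (2 * (8 * h ^ 2 %/ N) + 1) * (2 * (12 * h ^ 3 %/ N) + 1))%N.
Proof.
move=> h0 b0 bc hbN cN Nmax uss small hom.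
case: ss uss small hom => // P0 ss; set SS := _ :: _ => uss small hom.
have P0S : P0 \in SS by rewrite mem_head.
have N0 : (0 < N)%N by rewrite (leq_trans _ hbN) // muln_gt0 h0 absz_gt0.
have H P : P \in SS -> exists al ga,
    P = (P0.1.1 + b * al, P0.1.2 + (c * al + b * ga), P0.2 + c * ga).
  move=> PS; have := hom _ _ PS P0S.
  move: P P0 {PS P0S uss small hom SS} => [[A B] C] [[A0 B0] C0] /=.
  move=> /eqP; rewrite -subr_eq0 => /eqP e0.
  have [] := @quad_res_factor b c b0 bc (A - A0, B - B0, C - C0).
    by rewrite -e0 /quad_res /=; ring.
  move=> al [ga [e1 e2 e3]]; exists al, ga; rewrite -e1 -e2 -e3.
  by congr (_, _, _); ring.
pose al (P : int * int * int) : int := ((P.1.1 - P0.1.1) %/ b)%Z.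
pose ga (P : int * int * int) : int := ((P.1.2 - P0.1.2 - c * al P) %/ b)%Z.
have HP P : P \in SS ->
    P = (P0.1.1 + b * al P, P0.1.2 + (c * al P + b * ga P), P0.2 + c * ga P).
  move=> /H[x [y PE]]; have aE : al P = x.
    by rewrite /al {1}PE /= (_ : _ - _ = x * b) ?mulzK //; ring.
  have gE : ga P = y.
    by rewrite /ga aE {1}PE /= (_ : _ - c * x = y * b) ?mulzK //; ring.
  by rewrite aE gE.
rewrite -!size_zball -(size_allpairs pair).
apply: (@size_inj_le _ _ (fun P => (al P, ga P))) => //.
  by move=> P P' PS PS' [ea eg]; rewrite [LHS](HP _ PS) [RHS](HP _ PS') ea eg.
move=> P PS; have PE := HP _ PS.
move: (small _ PS) (small _ P0S); rewrite {1}PE /quad_small /=.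
move: (al P) (ga P) => x y /and3P[a1 a2 a3] /and3P[a4 a5 a6].
have ba := zdiff_bound a1 a4.
have cg := zdiff_bound a3 a6.
have bb := zdiff_bound a2 a5.
rewrite !abszM in ba cg.
have bb1 : (`|b| * `|y| <= 2 * (3 * h ^ 2) + `|c| * `|x|)%N.
  by rewrite -!abszM; apply: zadd_bound_inv; rewrite addrC.
have bb2 : (`|c| * `|x| <= 2 * (3 * h ^ 2) + `|b| * `|y|)%N.
  by rewrite -!abszM; apply: zadd_bound_inv.
suff /andP[xN yN] : ((`|x|%N * N <= 8 * h ^ 2) && (`|y|%N * N <= 12 * h ^ 3))%N.
  by apply: allpairs_f; apply: mem_zball; rewrite leq_divRL.
apply: (@homogeneous_bounds h N `|b| `|c|) => //.
Qed.

(** After multiplication by [N * p], the constant is 306 = 288 + 18: the part 288 uses [h ^ 4 <= p]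
    and the part 18 uses [h ^ 2 <= N]. *)
Lemma lead_count_bound (h N p x y : nat) :
  (0 < N)%N -> (0 < p)%N -> (h ^ 4 <= p)%N -> (h ^ 2 <= N)%N -> (N <= 6 * h ^ 3)%N ->
  (x * p <= 8 * h ^ 2 * N)%N -> (y * N <= 6 * h ^ 3)%N ->
  ((2 * x + 1) * (2 * y + 1) <= 306 * h)%N.
Proof.
move=> N0 p0 hp N2 N6 q1 q2.
have r1 : ((2 * y + 1) * N <= 18 * h ^ 3)%N by clear -N6 q2; lia.
have r2 : ((2 * x + 1) * p <= 16 * h ^ 2 * N + p)%N by clear -q1; lia.
have r3 := leq_mul r1 r2.
have s1 := leq_mul hp (leqnn (288 * h * N)%N).
have s2 := leq_mul N2 (leqnn (18 * h * p)%N).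
rewrite -(leq_pmul2r (m := N * p)) ?muln_gt0 ?N0 //.
move: r3 s1 s2; clear; lia.
Qed.

(** The three factors are at most [21 * h * N ^ 2 / p], [17 * h ^ 2 / N] and [25 * h ^ 3 / N];
    [7 * h ^ 4 <= p] then leaves 1275 = 21 * 17 * 25 / 7. *)
Lemma mid_count_bound (h N p x y z : nat) :
  (0 < h)%N -> (0 < N)%N -> (0 < p)%N -> (7 * h ^ 4 <= p)%N -> (N <= h ^ 2)%N ->
  (p <= 7 * h * N ^ 2)%N ->
  (x * p <= 7 * h * N ^ 2)%N -> (y * N <= 8 * h ^ 2)%N -> (z * N <= 12 * h ^ 3)%N ->
  ((2 * x + 1) * ((2 * y + 1) * (2 * z + 1)) <= 1275 * h ^ 2)%N.
Proof.
move=> h0 N0 p0 hp N2 pN q1 q2 q3.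
have r1 : ((2 * x + 1) * p <= 21 * h * N ^ 2)%N by clear -pN q1; lia.
have r2 : ((2 * y + 1) * N <= 17 * h ^ 2)%N by clear -N2 q2; lia.
have N3 : (N <= h ^ 3)%N by apply: leq_trans N2 _; rewrite leq_pexp2l.
have r3 : ((2 * z + 1) * N <= 25 * h ^ 3)%N by clear -N3 q3; lia.
have r4 := leq_mul r1 (leq_mul r2 r3).
have r5 := leq_mul hp (leqnn (1275 * h ^ 2 * (N * N))%N).
rewrite -(leq_pmul2r (m := p * (N * N))) ?muln_gt0 ?N0 ?p0 //.
move: r4 r5; clear; lia.
Qed.

(** Points on a line of primitive direction [(b, c)] differ by integer multiples [t] of [(b, c)],
    and the box forces [|t| * N <= 6 * h ^ 3]. *)
Lemma size_collinear (h N : nat) (b c : int) (ss : seq (int * int)) :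
  (0 < h)%N -> b != 0 -> coprimez b c -> (N <= h * `|b|)%N || (N <= `|c|)%N -> (0 < N)%N ->
  uniq ss -> {in ss, forall w, (`|w.1| <= 3 * h ^ 2)%N && (`|w.2| <= h ^ 3)%N} ->
  {in ss &, forall w w', w.1 * c - b * w.2 = w'.1 * c - b * w'.2} ->
  (size ss <= 2 * (6 * h ^ 3 %/ N) + 1)%N.
Proof.
move=> h0 b0 bc Nmax N0 uss small hom.
case: ss uss small hom => // w0 ss; set SS := _ :: _ => uss small hom.
have w0S : w0 \in SS by rewrite mem_head.
pose t (w : int * int) : int := ((w.1 - w0.1) %/ b)%Z.
have Hw w : w \in SS -> w = (w0.1 + b * t w, w0.2 + c * t w).
  move=> wS; have := hom _ _ wS w0S => e0.
  have [|u [e1 e2]] := @collinear_mult b c b0 bc (w.1 - w0.1) (w.2 - w0.2).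
    by apply/eqP; rewrite -subr_eq0 -(subrr (w0.1 * c - b * w0.2)) -{1}e0; apply/eqP; ring.
  have tE : t w = u by rewrite /t e1 mulrC mulzK.
  rewrite tE -e1 -e2; case: (w) => x y /=; congr (_, _); ring.
rewrite -size_zball; apply: (@size_inj_le _ _ t) => //.
  by move=> w w' wS wS' et; rewrite [LHS](Hw _ wS) [RHS](Hw _ wS') et.
move=> w wS; have wE := Hw _ wS.
move: (small _ w0S) (small _ wS); rewrite {1 2}wE /=.
move: (t w) => x /andP[a3 a4] /andP[a1 a2].
have bx := zdiff_bound a1 a3.
have cx := zdiff_bound a2 a4.
apply: mem_zball; rewrite leq_divRL //.
rewrite !abszM in bx cx.
case/orP: Nmax => [Nb|Nc].
  apply: leq_trans (leq_mul (leqnn _) Nb) _.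
  have := leq_mul (leqnn h) bx; move: bx; clear.
  move: `|b|%N `|x|%N => u v.
  lia.
apply: leq_trans (leq_mul (leqnn _) Nc) _.
move: cx; clear; move: `|c|%N `|x|%N => u v.
lia.
Qed.

(** Large height [N]. For each of the at most [7 * h] leading coefficients, the remaining pairs lie
    on few lines of direction [(b, c)], and each line carries few points; 2142 = 7 * 306. *)
Lemma size_quad_lead (p h N : nat) (s b c : int) (ss : seq (int * int * int)) :
  prime p -> (0 < h)%N -> (h ^ 4 <= p)%N -> b != 0 -> coprimez b c ->
  (h * `|b| <= N)%N -> (`|c| <= N)%N -> (N <= h * `|b|)%N || (N <= `|c|)%N ->
  (N <= 6 * h ^ 3)%N -> (h ^ 2 <= N)%N ->
  (p%:Z %| b * s + c)%Z ->
  uniq ss -> {in ss, forall P, quad_small h P && (p%:Z %| quad_eval P s)%Z} ->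
  (size ss <= 2142 * h ^ 2)%N.
Proof.
move=> pp h0 hp b0 bc hbN cN Nmax N6 N2 bsc uss Hss.
have p0 := prime_gt0 pp.
have N0 : (0 < N)%N by rewrite (leq_trans _ hbN) // muln_gt0 h0 absz_gt0.
suff H A : (size [seq P <- ss | P.1.1 == A] <= 306 * h)%N.
  have : (size ss <= (2 * (3 * h) + 1) * (306 * h))%N.
    rewrite -size_zball; apply: (@size_fibers _ _ (fun P : int * int * int => P.1.1)).
      by move=> P /Hss/andP[/and3P[? _ _] _]; apply: mem_zball.
    by move=> A _; exact: H.
  move/leq_trans; apply; move: h0; clear; nia.
set sA := [seq P <- ss | _].
have sAP P : P \in sA -> [/\ P.1.1 = A, quad_small h P & (p%:Z %| quad_eval P s)%Z].
  by rewrite mem_filter => /andP[/eqP ? /Hss/andP[? ?]].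
pose ws := [seq (P.1.2, P.2) | P <- sA].
have wsP w : w \in ws -> [/\ (`|w.1| <= 3 * h ^ 2)%N, (`|w.2| <= h ^ 3)%N
    & (p%:Z %| A * s ^+ 2 + w.1 * s + w.2)%Z].
  move=> /mapP[P /sAP[PA /and3P[P1 P2 P3] PS] ->] /=; split => //.
  by rewrite -PA.
have uws : uniq ws.
  rewrite map_inj_in_uniq ?filter_uniq //.
  move=> [[x y] z] [[x' y'] z'] /sAP[/= -> _ _] /sAP[/= -> _ _] [-> ->] //.
have -> : size sA = size ws by rewrite size_map.
clearbody ws; clear sA sAP Hss uss ss.
case: ws wsP uws => // w0 ws; set SS := _ :: _ => wsP uws.
have [w01 w02 w03] : [/\ (`|w0.1| <= 3 * h ^ 2)%N, (`|w0.2| <= h ^ 3)%N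
    & (p%:Z %| A * s ^+ 2 + w0.1 * s + w0.2)%Z] by apply: wsP; rewrite mem_head.
(* The determinant of [w - w0] and [(b, c)]. Modulo [p] both vectors satisfy [x * s + y = 0], so it
   is a multiple of [p]; its value determines the line through [w]. *)
pose D (w : int * int) : int := (w.1 - w0.1) * c - b * (w.2 - w0.2).
have Dp w : w \in SS -> (p%:Z %| D w)%Z.
  move=> /wsP[_ _ w3].
  have -> : D w = (w.1 - w0.1) * (b * s + c) -
      b * ((A * s ^+ 2 + w.1 * s + w.2) - (A * s ^+ 2 + w0.1 * s + w0.2)).
    by rewrite /D; ring.
  by apply: rpredB; apply: dvdz_mull => //; apply: rpredB.
have Dle w : w \in SS -> (`|D w| <= 8 * h ^ 2 * N)%N.
  move=> /wsP[w1 w2 _].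
  have e1 := zmul_bound (zsub_bound w1 w01) cN.
  have e2 := zmul_bound (leqnn `|b|) (zsub_bound w2 w02).
  apply: leq_trans (zsub_bound e1 e2) _.
  have := leq_mul (leqnn (2 * h ^ 2)%N) hbN; clear; move: (`|b|)%N => u; lia.
have : (size SS <= (2 * (8 * h ^ 2 * N %/ p) + 1) * (2 * (6 * h ^ 3 %/ N) + 1))%N.
  rewrite -{1}size_zball; apply: (@size_fibers _ _ (fun w => (D w %/ p%:Z)%Z)).
    by move=> w wS; apply: mem_zball; apply: absz_divz_le => //; [exact: Dle|exact: Dp].
  move=> u _; apply: (@size_collinear h N b c) => //; first exact: filter_uniq.
    by move=> w; rewrite mem_filter => /andP[_ /wsP[-> ->]].
  move=> w w'; rewrite !mem_filter => /andP[/eqP e1 wS] /andP[/eqP e2 wS'].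
  have : D w = D w' by rewrite -(divzK (Dp _ wS)) e1 -e2 divzK // Dp.
  move=> e3; apply/eqP; rewrite -subr_eq0; apply/eqP.
  by transitivity (D w - D w'); [rewrite /D; ring|rewrite e3 subrr].
move/leq_trans; apply.
have q1 := leq_divM (8 * h ^ 2 * N) p.
have q2 := leq_divM (6 * h ^ 3) N.
exact: lead_count_bound hp N2 N6 q1 q2.
Qed.

(** The three terms of [quad_res] contribute 3, 3 and 1 times [h * N ^ 2], since [h * |b|] and [|c|]
    are at most [N]. *)
Lemma quad_res_le (h N : nat) (b c : int) P :
  (h * `|b| <= N)%N -> (`|c| <= N)%N -> quad_small h P ->
  (`|quad_res b c P| <= 7 * h * N ^ 2)%N.
Proof.
move=> hbN cN /and3P[P1 P2 P3]; rewrite /quad_res.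
have e1 : (`|(P.1.1 * c ^+ 2)%R| <= 3 * h * (N * N))%N.
  by rewrite expr2; do 2!apply: zmul_bound => //.
have e2 : (`|(P.1.2 * b * c)%R| <= 3 * h ^ 2 * `|b| * N)%N.
  by do 2!apply: zmul_bound => //.
have e3 : (`|(P.2 * b ^+ 2)%R| <= h ^ 3 * (`|b| * `|b|))%N.
  by rewrite expr2; do 2!apply: zmul_bound => //.
apply: leq_trans (zadd_bound (zsub_bound e1 e2) e3) _.
have := leq_mul (leqnn (3 * h * N)%N) hbN.
have := leq_mul (leqnn h) (leq_mul hbN hbN).
by clear; move: (`|b|)%N => u; lia.
Qed.

(** Moderate height [N]. The quadratics are sorted by the value of [quad_res], a multiple of [p] of
    size at most [7 * h * N ^ 2], and each value is treated by [size_homogeneous]. *)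
Lemma size_quad_mid (p h N : nat) (s b c : int) (ss : seq (int * int * int)) :
  prime p -> (0 < h)%N -> (7 * h ^ 4 <= p)%N -> b != 0 -> coprimez b c ->
  (h * `|b| <= N)%N -> (`|c| <= N)%N -> (N <= h * `|b|)%N || (N <= `|c|)%N ->
  (N <= h ^ 2)%N -> (p <= 7 * h * N ^ 2)%N ->
  (p%:Z %| b * s + c)%Z ->
  uniq ss -> {in ss, forall P, quad_small h P && (p%:Z %| quad_eval P s)%Z} ->
  (size ss <= 1275 * h ^ 2)%N.
Proof.
move=> pp h0 hp b0 bc hbN cN Nmax N2 pN bsc uss Hss.
have p0 := prime_gt0 pp.
have N0 : (0 < N)%N by rewrite (leq_trans _ hbN) // muln_gt0 h0 absz_gt0.
have Qp P : P \in ss -> (p%:Z %| quad_res b c P)%Z.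
  by move=> /Hss/andP[_]; exact: (quad_res_dvd bsc).
have Qle P : P \in ss -> (`|quad_res b c P| <= 7 * h * N ^ 2)%N.
  by move=> /Hss/andP[hP _]; exact: quad_res_le.
have : (size ss <= (2 * (7 * h * N ^ 2 %/ p) + 1)
     * ((2 * (8 * h ^ 2 %/ N) + 1) * (2 * (12 * h ^ 3 %/ N) + 1)))%N.
  rewrite -{1}size_zball; apply: (@size_fibers _ _ (fun P => (quad_res b c P %/ p%:Z)%Z)).
    by move=> P PS; apply: mem_zball; apply: absz_divz_le => //; [exact: Qle|exact: Qp].
  move=> u _; apply: (@size_homogeneous h N b c) => //; first exact: filter_uniq.
    by move=> P; rewrite mem_filter => /andP[_ /Hss/andP[]].
  move=> P P'; rewrite !mem_filter => /andP[/eqP e1 PS] /andP[/eqP e2 PS'].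
  by rewrite -(divzK (Qp _ PS)) e1 -e2 divzK // Qp.
move/leq_trans; apply.
have q1 := leq_divM (7 * h * N ^ 2) p.
have q2 := leq_divM (8 * h ^ 2) N.
have q3 := leq_divM (12 * h ^ 3) N.
exact: mid_count_bound hp N2 pN q1 q2 q3.
Qed.

(** The gcd of [b] and [c] divides the nonzero [b], which is smaller than [p]; it is therefore prime
    to [p] and can be cancelled in the congruence. *)
Lemma primitive_relation (p : nat) (s b c : int) :
  prime p -> b != 0 -> (`|b| < p)%N -> (p%:Z %| b * s + c)%Z ->
  exists b' c', [/\ b' != 0, coprimez b' c', (`|b'| <= `|b|)%N, (`|c'| <= `|c|)%N
    & (p%:Z %| b' * s + c')%Z].
Proof.
move=> pp b0 bp bsc; have p0 := prime_gt0 pp.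
have /dvdzP[b' bE] := dvdz_gcdl b c.
have /dvdzP[c' cE] := dvdz_gcdr b c.
have g0 : gcdz b c != 0 by rewrite gcdz_eq0 negb_and b0.
have g1 : (0 < `|gcdz b c|)%N by rewrite absz_gt0.
exists b', c'; split.
- by apply: contraNneq b0 => b'0; rewrite bE b'0 mul0r.
- rewrite /coprimez; apply/eqP; apply: (mulIf g0).
  have := congr2 gcdz bE cE; rewrite -mulz_gcdl => <-; by rewrite mul1r.
- by rewrite [in X in (_ <= X)%N]bE abszM leq_pmulr.
- by rewrite [in X in (_ <= X)%N]cE abszM leq_pmulr.
- move: bsc; rewrite (_ : _ + _ = gcdz b c * (b' * s + c')); last first.
    by rewrite mulrDr [_ * c']mulrC -cE {1}bE; congr (_ + _); ring.
  rewrite Gauss_dvdzr // /coprimez /gcdz absz_nat; apply/eqP; congr Posz.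
  apply/eqP; change (coprime p `|gcdz b c|); rewrite prime_coprime //.
  rewrite gtnNdvd //; apply: leq_ltn_trans bp; rewrite dvdn_leq ?absz_gt0 //.
  by rewrite -dvdzE dvdz_gcdl.
Qed.

(* Either the quadratics with a root [s] modulo [p] are as few as the volume of
   the box predicts, or they share a rational root [- c / b]. *)
Lemma quad_points (p h : nat) (s : int) (ss : seq (int * int * int)) :
  prime p -> (0 < h)%N -> (7 * h ^ 4 <= p)%N ->
  uniq ss -> {in ss, forall P, quad_small h P && (p%:Z %| quad_eval P s)%Z} ->
  (size ss <= 2142 * h ^ 2)%N \/
  exists b c, [/\ b != 0, (`|b| <= 6 * h ^ 2)%N, (`|c| <= 2 * h ^ 3)%N
    & {in ss, forall P, quad_res b c P = 0}].
Proof.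
move=> pp h0 hp uss Hss.
have p0 := prime_gt0 pp.
have hp2 : (6 * h ^ 2 < p)%N by apply: leq_trans hp; move: h0; clear; nia.
have hp3 : (2 * h ^ 3 < p)%N by apply: leq_trans hp; move: h0; clear; nia.
have hp4 : (h ^ 4 <= p)%N by apply: leq_trans hp; rewrite leq_pmull.
(* Distinct leading coefficients leave at most [6 * h + 1] quadratics. Otherwise two of them share
   [A], and their difference is a linear relation on [s] modulo [p] with small coefficients. *)
have [Ainj|] := pselect {in ss &, injective (fun P : int * int * int => P.1.1)}.
  left; apply: leq_trans (_ : 2 * (3 * h) + 1 <= _)%N; last by move: h0; clear; nia.
  rewrite -size_zball; apply: (size_inj_le uss Ainj).
  by move=> P /Hss/andP[/and3P[? _ _] _]; apply: mem_zball.
move=> /existsNP[P] /existsNP[P'] /not_implyP[PS] /not_implyP[PS'] /not_implyP[/= A PP'].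
have /andP[/and3P[_ P2 P3] Pp] := Hss _ PS.
have /andP[/and3P[_ P2' P3'] Pp'] := Hss _ PS'.
have sbc : (p%:Z %| (P.1.2 - P'.1.2) * s + (P.2 - P'.2))%Z.
  rewrite (_ : _ * s + _ = quad_eval P s - quad_eval P' s); last first.
    by rewrite /quad_eval A; ring.
  exact: rpredB.
have bb := zsub_bound P2 P2'.
have cc := zsub_bound P3 P3'.
(* If the linear coefficient were zero, the constant one would be a multiple of [p] below [p], hence
   zero, and the two quadratics would coincide. *)
have bn0 : P.1.2 - P'.1.2 != 0.
  apply/eqP => b0; rewrite b0 mul0r add0r in sbc.
  have c0 : P.2 - P'.2 = 0.
    apply/eqP; rewrite -absz_eq0; apply/negPn/negP; rewrite -lt0n => c0.
    have := dvdn_leq c0 sbc; rewrite leqNgt; apply/negP/negPn.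
    by apply: leq_ltn_trans cc _; rewrite addnn -mul2n.
  move/eqP: b0; move/eqP: c0; rewrite !subr_eq0 => /eqP c0 /eqP b0; apply: PP'.
  by case: (P) (P') A b0 c0 => [[x y] z] [[x' y'] z'] /= -> -> ->.
have b6 : (`|P.1.2 - P'.1.2| <= 6 * h ^ 2)%N by apply: leq_trans bb _; clear; lia.
have c2 : (`|P.2 - P'.2| <= 2 * h ^ 3)%N by apply: leq_trans cc _; clear; lia.
have [b [c [b0 bc bb' cc' bsc]]] := primitive_relation pp bn0 (leq_ltn_trans b6 hp2) sbc.
have {bb' bb}b6 := leq_trans bb' b6.
have {cc' cc}c2 := leq_trans cc' c2.
clear sbc bn0 P P' PS PS' A PP' P2 P3 P2' P3' Pp Pp'.
(* The height of [- c / b], with the weight [h] on [b] that bounds all three terms of [quad_res] by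
   multiples of [h * N ^ 2]. *)
pose N := maxn (h * `|b|) `|c|.
have hbN : (h * `|b| <= N)%N by rewrite leq_maxl.
have cN : (`|c| <= N)%N by rewrite leq_maxr.
have Nmax : (N <= h * `|b|)%N || (N <= `|c|)%N.
  by rewrite !geq_max !leqnn andbT /= leq_total.
have N6 : (N <= 6 * h ^ 3)%N.
  rewrite geq_max; apply/andP; split.
    by apply: leq_trans (leq_mul (leqnn h) b6) _; clear; lia.
  by apply: leq_trans c2 _; rewrite leq_mul2r orbT.
(* For small height [quad_res] is a multiple of [p] of size below [p], so it vanishes on the whole
   list. Larger heights are split at [h ^ 2]. *)
have [Np|pN] := ltnP (7 * h * N ^ 2) p.
  right; exists b, c; split => // P PS.
  have /andP[PS1 PS2] := Hss _ PS.
  have dv := quad_res_dvd bsc PS2.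
  have le := quad_res_le hbN cN PS1.
  apply/eqP; rewrite -absz_eq0; apply/negPn/negP; rewrite -lt0n => c0.
  have := dvdn_leq c0 dv; rewrite leqNgt; apply/negP/negPn.
  exact: leq_ltn_trans le Np.
left; have [N2|N2] := leqP N (h ^ 2).
  apply: leq_trans (size_quad_mid pp h0 hp b0 bc hbN cN Nmax N2 pN bsc uss Hss) _.
  by rewrite leq_mul2r orbT.
exact: size_quad_lead pp h0 hp4 b0 bc hbN cN Nmax N6 (ltnW N2) bsc uss Hss.
Qed.

(** * Multiplicative energies *)

(** The common value is required to be nonzero: this matches the condition on the exponential sum
    and allows division by the variables. *)
Definition hits (F : fieldType) (X Y : finType) (f : X -> F) (g : Y -> F) : nat :=
  #|[pred z : X * Y | (f z.1 == g z.2) && (f z.1 != 0)]|.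

Definition prod2 (F : fieldType) (X Y : finType) (f : X -> F) (g : Y -> F) (z : X * Y) : F :=
  f z.1 * g z.2.

Definition prod3 (F : fieldType) (X Y Z : finType) (f : X -> F) (g : Y -> F) (h : Z -> F)
  (z : X * Y * Z) : F := f z.1.1 * g z.1.2 * h z.2.

Definition energy2 (F : fieldType) (X Y : finType) (f : X -> F) (g : Y -> F) :=
  hits (prod2 f g) (prod2 f g).

Definition energy3 (F : fieldType) (X Y Z : finType) (f : X -> F) (g : Y -> F) (h : Z -> F) :=
  hits (prod3 f g h) (prod3 f g h).

(** Cauchy-Schwarz over the naturals: twice the inequality is symmetrized into a double sum and
    holds termwise by [2 * x * y <= x ^ 2 + y ^ 2]. *)
Lemma sqr_sum_mul_le (I : finType) (a b : I -> nat) :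
  ((\sum_i a i * b i) ^ 2 <= (\sum_i a i ^ 2) * (\sum_i b i ^ 2))%N.
Proof.
rewrite -(leq_pmul2l (m := 2)) // expnS expn1 !big_distrlr /= !big_distrr /=.
have -> : (\sum_i 2 * \sum_j a i ^ 2 * b j ^ 2 =
    \sum_i \sum_j (a i ^ 2 * b j ^ 2 + a j ^ 2 * b i ^ 2))%N.
  transitivity (\sum_i \sum_j a i ^ 2 * b j ^ 2 + \sum_i \sum_j a j ^ 2 * b i ^ 2)%N.
    by rewrite [X in (_ = _ + X)%N]exchange_big /= addnn -mul2n big_distrr.
  by rewrite -big_split; apply: eq_bigr => i _; rewrite -big_split.
apply: leq_sum => i _; rewrite big_distrr /=; apply: leq_sum => j _.
have := (nat_Cauchy (a i * b j) (a j * b i)).1; rewrite !expnMn.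
move: (a i) (a j) (b i) (b j) => x y z t; lia.
Qed.

Section Hits.
Variable F : finFieldType.

Lemma card_le_inj (X Y : finType) (A : pred X) (B : pred Y) (f : X -> Y) :
  injective f -> (forall x, A x -> B (f x)) -> (#|A| <= #|B|)%N.
Proof.
move=> fi AB; rewrite -(fintype.card_image fi); apply: subset_leq_card.
by apply/fintype.subsetP => _ /fintype.imageP[x xA ->]; apply: AB.
Qed.

Lemma hitsE (X Y : finType) (f : X -> F) (g : Y -> F) :
  hits f g = (\sum_(t | t != 0%R) #|[pred x | f x == t]| * #|[pred y | g y == t]|)%N.
Proof.
rewrite /hits -sum1_card (partition_big (fun z => f z.1) (fun t => t != 0)) /=; last first.
  by move=> z /andP[].
apply: eq_bigr => t t0; rewrite -!sum1_card big_distrlr /= pair_big_dep /=.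
apply: eq_bigl => -[x y]; rewrite !inE /=.
by case: (eqVneq (f x) t) => [->|]; rewrite ?andbF // t0 andbT andbT eq_sym.
Qed.

(** By [hitsE], [hits f g] is the inner product of the fiber counts of [f] and [g] on the nonzero
    elements, so Cauchy-Schwarz applies. *)
Lemma hits_sqr_le (X Y : finType) (f : X -> F) (g : Y -> F) :
  (hits f g ^ 2 <= hits f f * hits g g)%N.
Proof.
rewrite !hitsE !(big_mkcond (fun t => t != 0)) /=.
pose a t := if t != 0 then #|[pred x | f x == t]| else 0%N.
pose b t := if t != 0 then #|[pred x | g x == t]| else 0%N.
have := sqr_sum_mul_le a b.
rewrite (eq_bigr (fun t => if t != 0 then (#|[pred x | f x == t]| * #|[pred y | g y == t]|)%N
  else 0%N)) => [|t _]; last by rewrite /a /b; case: ifP.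
rewrite [X in (_ <= X * _)%N -> _](eq_bigr (fun t => if t != 0 then (#|[pred x | f x == t]| * #|[pred y | f y == t]|)%N
  else 0%N)) => [|t _]; last by rewrite /a; case: ifP; rewrite -?mulnn.
by rewrite [X in (_ <= _ * X)%N -> _](eq_bigr (fun t => if t != 0 then (#|[pred x | g x == t]| * #|[pred y | g y == t]|)%N
  else 0%N)) => [//|t _]; rewrite /b; case: ifP; rewrite -?mulnn.
Qed.

Lemma hits_le (X Y : finType) (f : X -> F) (g : Y -> F) M :
  (hits f f <= M)%N -> (hits g g <= M)%N -> (hits f g <= M)%N.
Proof.
move=> fM gM; rewrite -leq_sqr; apply: leq_trans (hits_sqr_le f g) _.
by rewrite -mulnn leq_mul.
Qed.

Definition quot2 (Z : finType) (k : Z -> F) (z : Z * Z) : F := k z.1 / k z.2.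

Lemma hits_quot2_le (Z : finType) (k : Z -> F) : (hits (quot2 k) (quot2 k) <= energy2 k k)%N.
Proof.
apply: (@card_le_inj _ _ _ _ (fun z => ((z.1.1, z.2.2), (z.2.1, z.1.2)))).
  by move=> [[a b] [c d]] [[a' b'] [c' d']] [-> -> -> ->].
move=> [[a b] [c d]]; rewrite !inE /quot2 /prod2 /= mulf_eq0 invr_eq0 negb_or.
move=> /and3P[e ka kb].
(* Since the inverse of zero is zero, [k d = 0] would make the right quotient zero while the left
   one is not. *)
have kd : k d != 0.
  by apply: contraTneq e => ->; rewrite invr0 mulr0 mulf_neq0 ?invr_neq0.
by rewrite mulf_neq0 // andbT -eqr_div.
Qed.

(** Rewriting [f a * g b = f c * g d] as [f a / f c = g d / g b] puts each function on its own side,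
    ready for Cauchy-Schwarz. *)
Lemma energy2_le_hits_quot2 (X Y : finType) (f : X -> F) (g : Y -> F) :
  (energy2 f g <= hits (quot2 f) (quot2 g))%N.
Proof.
apply: (@card_le_inj _ _ _ _ (fun z => ((z.1.1, z.2.1), (z.2.2, z.1.2)))).
  by move=> [[a b] [c d]] [[a' b'] [c' d']] [-> -> -> ->].
move=> [[a b] [c d]]; rewrite !inE /quot2 /prod2 /= => /andP[/eqP e ne].
have := ne; rewrite {1}e !mulf_eq0 !invr_eq0 !negb_or => /andP[fc gd].
move: ne; rewrite mulf_eq0 negb_or => /andP[fa gb].
by rewrite fa fc eqr_div // e mulrC eqxx.
Qed.

Lemma energy2_sqr_le (X Y : finType) (f : X -> F) (g : Y -> F) :
  (energy2 f g ^ 2 <= energy2 f f * energy2 g g)%N.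
Proof.
apply: leq_trans (leq_mul (hits_quot2_le f) (hits_quot2_le g)).
by apply: leq_trans (hits_sqr_le _ _); rewrite leq_sqr energy2_le_hits_quot2.
Qed.

Lemma energy2_le (X Y : finType) (f : X -> F) (g : Y -> F) M :
  (energy2 f f <= M)%N -> (energy2 g g <= M)%N -> (energy2 f g <= M)%N.
Proof.
move=> fM gM; rewrite -leq_sqr; apply: leq_trans (energy2_sqr_le f g) _.
by rewrite -mulnn leq_mul.
Qed.

(** An equation [f g h = f' g' h'] is read as [f g / f' = h' g' / h]. Cauchy-Schwarz separates the
    two sides, and clearing denominators turns the equations of one side with itself into an energy
    with two equal functions. *)
Lemma energy3_sqr_le (X Y Z : finType) (f : X -> F) (g : Y -> F) (h : Z -> F) :
  (energy3 f g h ^ 2 <= energy3 f f g * energy3 g h h)%N.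
Proof.
pose q (U V : finType) (k : U -> F) (l : V -> F) (z : U * V * U) := k z.1.1 * l z.1.2 / k z.2.
have q_le (U V : finType) (k : U -> F) (l : V -> F) :
    (hits (q U V k l) (q U V k l) <= energy3 k k l)%N.
  apply: (@card_le_inj _ _ _ _ (fun z => ((z.1.1.1, z.2.2, z.1.1.2), (z.2.1.1, z.1.2, z.2.1.2)))).
    by move=> [[[a b] c] [[a1 b1] c1]] [[[a' b'] c'] [[a1' b1'] c1']] [-> -> -> -> -> ->].
  move=> [[[a b] c] [[a1 b1] c1]]; rewrite !inE /q /prod3 /= => /andP[/eqP e ne].
  have := ne; rewrite {1}e !mulf_eq0 !invr_eq0 !negb_or => /andP[/andP[ka1 lb1] kc1].
  move: ne; rewrite !mulf_eq0 !invr_eq0 !negb_or => /andP[/andP[ka lb] kc].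
  rewrite ka kc1 lb !andbT; apply/eqP.
  move/eqP: e; rewrite eqr_div // => /eqP e.
  by rewrite mulrAC e mulrAC.
have sym (U V : finType) (k : U -> F) (l : V -> F) : (energy3 k k l <= energy3 l k k)%N.
  apply: (@card_le_inj _ _ _ _ (fun z => ((z.1.2, z.1.1.1, z.1.1.2), (z.2.2, z.2.1.1, z.2.1.2)))).
    by move=> [[[a b] c] [[a1 b1] c1]] [[[a' b'] c'] [[a1' b1'] c1']] [-> -> -> -> -> ->].
  move=> [[[a b] c] [[a1 b1] c1]]; rewrite !inE /prod3 /=.
  by rewrite -[l c * _ * _]mulrA -[l c1 * _ * _]mulrA [l c * _]mulrC [l c1 * _]mulrC.
apply: leq_trans (leq_mul (q_le _ _ f g) (leq_trans (q_le _ _ h g) (sym _ _ _ _))).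
apply: leq_trans (hits_sqr_le _ _); rewrite leq_sqr.
apply: (@card_le_inj _ _ _ _ (fun z => ((z.1.1.1, z.1.1.2, z.2.1.1), (z.2.2, z.2.1.2, z.1.2)))).
  by move=> [[[a b] c] [[a1 b1] c1]] [[[a' b'] c'] [[a1' b1'] c1']] [-> -> -> -> -> ->].
move=> [[[a b] c] [[a1 b1] c1]]; rewrite !inE /q /prod3 /= => /andP[/eqP e ne].
have := ne; rewrite {1}e !mulf_eq0 !negb_or => /andP[/andP[fa1 gb1] hc1].
move: ne; rewrite !mulf_eq0 !negb_or => /andP[/andP[fa gb] hc].
rewrite invr_eq0 fa gb fa1 !andbT eqr_div // e; apply/eqP; ring.
Qed.

Lemma energy3_le (X Y Z : finType) (f : X -> F) (g : Y -> F) (h : Z -> F) M :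
  (energy3 f f f <= M)%N -> (energy3 g g g <= M)%N -> (energy3 h h h <= M)%N ->
  (energy3 f g h <= M)%N.
Proof.
(* With [x = energy3 k k l] and [y = energy3 k l l], Cauchy-Schwarz gives [x ^ 2 <= M * y] and
   [y ^ 2 <= M * x], so the larger of the two is at most [M]. *)
have mix (U V : finType) (k : U -> F) (l : V -> F) :
    (energy3 k k k <= M)%N -> (energy3 l l l <= M)%N ->
    (energy3 k k l <= M)%N /\ (energy3 k l l <= M)%N.
  move=> kM lM; have e1 := energy3_sqr_le k k l; have e2 := energy3_sqr_le k l l.
  have {}e1 := leq_trans e1 (leq_mul kM (leqnn _)).
  have {}e2 := leq_trans e2 (leq_mul (leqnn _) lM).
  move: (energy3 _ _ _) (energy3 k l l) e1 e2 => x y; rewrite -!mulnn => e1 e2.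
  have sq_le z : (z * z <= M * z)%N -> (z <= M)%N.
    by case: z => // z; rewrite leq_pmul2r.
  have [xy|/ltnW yx] := leqP x y.
    have yM : (y <= M)%N.
      by apply: sq_le; apply: leq_trans e2 _; rewrite mulnC leq_mul2l xy orbT.
    by split => //; apply: leq_trans yM.
  have xM : (x <= M)%N.
    by apply: sq_le; apply: leq_trans e1 _; rewrite leq_mul2l yx orbT.
  by split => //; apply: leq_trans xM.
move=> fM gM hM; have [e1 _] := mix _ _ f g fM gM; have [_ e2] := mix _ _ g h gM hM.
rewrite -leq_sqr; apply: leq_trans (energy3_sqr_le f g h) _.
by rewrite -mulnn leq_mul.
Qed.
End Hits.

(** * Energies of short intervals *)

Lemma Fp_intr_eq0 (p : nat) (z : int) : prime p -> ((z%:~R : 'F_p) == 0) = (p%:Z %| z)%Z.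
Proof. by move=> pp; rewrite -(dvdz_pcharf (pchar_Fp pp)). Qed.

Lemma Fp_intr_eq (p : nat) (x y : int) : prime p ->
  ((x%:~R : 'F_p) == y%:~R) = (p%:Z %| x - y)%Z.
Proof. by move=> pp; rewrite -subr_eq0 -rmorphB Fp_intr_eq0. Qed.

Definition interval_fun (p h : nat) (s : int) (i : 'I_h) : 'F_p := (s + (i : nat)%:Z)%:~R.

Lemma card_le_in_inj (X Y : finType) (A : pred X) (B : pred Y) (f : X -> Y) :
  {in A &, injective f} -> (forall x, A x -> B (f x)) -> (#|A| <= #|B|)%N.
Proof.
move=> fi AB; rewrite -(fintype.card_in_image fi); apply: subset_leq_card.
by apply/fintype.subsetP => _ /fintype.imageP[x xA ->]; apply: AB.
Qed.

Lemma card_predU_le (X : finType) (A B C : pred X) :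
  (#|[pred x | A x && (B x || C x)]| <= #|[pred x | A x && B x]| + #|[pred x | A x && C x]|)%N.
Proof.
rewrite -cardUI -[X in (X <= _)%N]addn0; apply: leq_add => //.
apply: subset_leq_card; apply/fintype.subsetP => x; rewrite !inE.
by rewrite -andb_orr.
Qed.

(** * Products of three elements of a short interval *)

Section CubicCongruence.
Variables (p h : nat) (s : int).
Hypotheses (pp : prime p) (h0 : (0 < h)%N).
Local Notation f := (interval_fun p (h := h) s).
Local Notation T := ('I_h * 'I_h * 'I_h * ('I_h * 'I_h * 'I_h))%type.

Definition cubic_sols : pred T := [pred z | (prod3 f f f z.1 == prod3 f f f z.2) && (prod3 f f f z.1 != 0)].

Definition meets (z : T) : bool :=
  let: (a, b, c, (a', b', c')) := z in
  (a == a') || ((a == b') || ((a == c') || ((b == a') || ((b == b') || ((b == c') ||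
  ((c == a') || ((c == b') || (c == c')))))))).

Definition symmetry3 (r : 'I_h * 'I_h * 'I_h -> 'I_h * 'I_h * 'I_h) :=
  injective r /\ forall x, prod3 f f f (r x) = prod3 f f f x.

(** The shared variable has [h] values; cancelling its nonzero factor leaves an equation between
    products of two. The symmetries [r] and [r'] move it to the first place. *)
Lemma card_meet r r' : symmetry3 r -> symmetry3 r' ->
  (#|[pred z | cubic_sols z && ((r z.1).1.1 == (r' z.2).1.1)]| <= h * energy2 f f)%N.
Proof.
move=> [ri rP] [ri' rP'].
apply: leq_trans (_ : #|[pred z | cubic_sols z && (z.1.1.1 == z.2.1.1)]| <= _)%N.
  apply: (@card_le_in_inj _ _ _ _ (fun z => (r z.1, r' z.2))).
    by move=> [x y] [x' y'] _ _ [/ri -> /ri' ->].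
  by move=> [x y]; rewrite /cubic_sols /= !rP !rP'.
rewrite -[h in (h * _)%N]card_ord /energy2 /hits -cardX.
apply: (@card_le_in_inj _ _ _ _
  (fun z : T => (z.1.1.1, ((z.1.1.2, z.1.2), (z.2.1.2, z.2.2))))).
  move=> [[[a b] c] [[a' b'] c']] [[[a1 b1] c1] [[a1' b1'] c1']].
  rewrite !inE /= => /andP[_ /eqP aa] /andP[_ /eqP aa1] [e1 -> -> -> ->].
  by rewrite -aa -aa1 e1.
move=> [[[a b] c] [[a' b'] c']]; rewrite !inE /cubic_sols /prod3 /prod2 /=.
move=> /andP[/andP[/eqP e ne] /eqP aa]; rewrite -aa in e.
move: ne; rewrite -!mulrA mulf_eq0 negb_or => /andP[fa ->]; rewrite andbT.
by apply/eqP; apply: (mulfI fa); rewrite !mulrA.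
Qed.

Lemma card_meets : (#|[pred z | cubic_sols z && meets z]| <= 9 * (h * energy2 f f))%N.
Proof.
(* Permutations bringing each of the three coordinates to the front; the nine pairs of them are the
   nine coincidences in [meets]. *)
pose r1 (x : 'I_h * 'I_h * 'I_h) := x.
pose r2 (x : 'I_h * 'I_h * 'I_h) := (x.1.2, x.1.1, x.2).
pose r3 (x : 'I_h * 'I_h * 'I_h) := (x.2, x.1.1, x.1.2).
have s1 : symmetry3 r1 by split=> // x y.
have s2 : symmetry3 r2.
  split; first by move=> [[a b] c] [[a' b'] c'] [-> -> ->].
  by move=> [[a b] c]; rewrite /prod3 /= [X in X * _]mulrC.
have s3 : symmetry3 r3.
  split; first by move=> [[a b] c] [[a' b'] c'] [-> -> ->].
  by move=> [[a b] c]; rewrite /prod3 /= -mulrA mulrC.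
pose E (r r' : 'I_h * 'I_h * 'I_h -> 'I_h * 'I_h * 'I_h) (z : T) : bool := (r z.1).1.1 == (r' z.2).1.1.
have -> : #|[pred z | cubic_sols z && meets z]| = #|[pred z | cubic_sols z &&
    (E r1 r1 z || (E r1 r2 z || (E r1 r3 z || (E r2 r1 z || (E r2 r2 z || (E r2 r3 z ||
    (E r3 r1 z || (E r3 r2 z || E r3 r3 z))))))))]|.
  by apply: eq_card => -[[[a b] c] [[a' b'] c']].
have Ele r r' : symmetry3 r -> symmetry3 r' ->
  (#|[pred z | cubic_sols z && E r r' z]| <= h * energy2 f f)%N := @card_meet r r'.
do 8![apply: leq_trans (card_predU_le _ _ _) _; rewrite mulSn; apply: leq_add; first exact: Ele].
by rewrite mul1n; exact: Ele.
Qed.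

Local Notation v := (fun i : 'I_h => (i : nat)%:Z).

(** The coefficients of [(Z + a)(Z + b)(Z + c) - (Z + a')(Z + b')(Z + c')], whose cubic terms
    cancel. *)
Definition diff_quad (z : T) : int * int * int :=
  let: (a, b, c, (a', b', c')) := z in
  (v a + v b + v c - (v a' + v b' + v c'),
   v a * v b + v a * v c + v b * v c - (v a' * v b' + v a' * v c' + v b' * v c'),
   v a * v b * v c - v a' * v b' * v c').

Lemma diff_quad_evalE (a b c a' b' c' : 'I_h) (t : int) :
  quad_eval (diff_quad (a, b, c, (a', b', c'))) t =
  (t + v a) * (t + v b) * (t + v c) - (t + v a') * (t + v b') * (t + v c').
Proof. by rewrite /quad_eval /=; ring. Qed.

(** Evaluation of the difference of cubics at [Z = - u / t], cleared by [t ^+ 3]; [quad_res]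
    accounts for [t ^+ 2] of it, hence the extra factor [t]. *)
Lemma diff_quad_resE (a b c a' b' c' : 'I_h) (t u : int) :
  t * quad_res t u (diff_quad (a, b, c, (a', b', c'))) =
  (t * v a - u) * (t * v b - u) * (t * v c - u)
   - (t * v a' - u) * (t * v b' - u) * (t * v c' - u).
Proof. by rewrite /quad_res /=; ring. Qed.

Lemma diff_quad_small (z : T) : quad_small h (diff_quad z).
Proof.
case: z => [[[a b] c] [[a' b'] c']]; rewrite /quad_small /=.
(* Both terms of each coefficient are nonnegative, so their difference obeys the bound of a single
   term and no factor 2 is lost. *)
have H (x y : int) (m : nat) : 0 <= x -> 0 <= y -> (`|x| <= m)%N -> (`|y| <= m)%N ->
  (`|(x - y)%R| <= m)%N by clear; lia.
have L (i : 'I_h) : (`|v i| <= h)%N by rewrite absz_nat ltnW.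
have e1 (i j k : 'I_h) := zadd_bound (zadd_bound (L i) (L j)) (L k).
have e2 (i j k : 'I_h) := zadd_bound (zadd_bound (zmul_bound (L i) (L j))
  (zmul_bound (L i) (L k))) (zmul_bound (L j) (L k)).
have e3 (i j k : 'I_h) := zmul_bound (zmul_bound (L i) (L j)) (L k).
apply/and3P; split; apply: H; rewrite ?addr_ge0 ?mulr_ge0 //.
- by apply: leq_trans (e1 _ _ _) _; clear; lia.
- by apply: leq_trans (e1 _ _ _) _; clear; lia.
- by apply: leq_trans (e2 _ _ _) _; clear; lia.
- by apply: leq_trans (e2 _ _ _) _; clear; lia.
- by apply: leq_trans (e3 _ _ _) _; clear; lia.
- by apply: leq_trans (e3 _ _ _) _; clear; lia.
Qed.

Lemma diff_quad_dvd z : cubic_sols z -> (p%:Z %| quad_eval (diff_quad z) s)%Z.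
Proof.
case: z => [[[a b] c] [[a' b'] c']]; rewrite /cubic_sols /prod3 /= => /andP[+ _].
by rewrite /interval_fun -!rmorphM Fp_intr_eq // diff_quad_evalE.
Qed.

(** The range [512 * h ^ 9] is the cube of [8 * h ^ 3], which bounds the factors [t * v i - u] for a
    rational root [- u / t] below. *)
Variable D : nat.
Hypothesis HD : forall n, (0 < n)%N -> (n <= 512 * h ^ 9)%N -> (size (divisors n) <= D)%N.

Lemma size_zdivisors_le (n : int) :
  n != 0 -> (`|n| <= 512 * h ^ 9)%N -> (size (zdivisors n) <= 2 * D)%N.
Proof. by move=> n0 nh; rewrite size_zdivisors leq_mul2l HD // absz_gt0. Qed.

Definition cubic_rest : seq T := enum [pred z | cubic_sols z && ~~ meets z].

Lemma cubic_restP z : z \in cubic_rest -> cubic_sols z /\ ~~ meets z.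
Proof. by rewrite mem_enum inE => /andP[]. Qed.

(** An empty list is harmless, so a member may be assumed; in the divisor arguments it supplies the
    factorization that shows the number to be nonzero and small. *)
Lemma size_le_mem (X : eqType) (l : seq X) m :
  (forall x, x \in l -> (size l <= m)%N) -> (size l <= m)%N.
Proof. by case: l => // x l H; apply: (H x); rewrite mem_head. Qed.

(** Fix [a'], in [h] ways. Then [P(- a') = (a - a')(b - a')(c - a')] is a known nonzero integer, so
    three divisors give [a], [b], [c]. Next [- P(- a) = (a' - a)(b' - a)(c' - a)] is known, and two
    divisors give [b'] and [c']. *)
Lemma size_same_diff_quad P :
  (size [seq z <- cubic_rest | diff_quad z == P] <= h * ((2 * D) ^ 3 * (2 * D) ^ 2))%N.
Proof.
have vI (i j : 'I_h) : (v i == v j) = (i == j) by [].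
have dle (i j k l : 'I_h) : (`|((v i - v l) * (v j - v l) * (v k - v l))%R| <= 512 * h ^ 9)%N.
  have L (i1 j1 : 'I_h) : (`|(v i1 - v j1)%R| <= h)%N.
    by have := ltn_ord i1; have := ltn_ord j1; clear; move: (nat_of_ord i1) (nat_of_ord j1) => x y; lia.
  apply: leq_trans (zmul_bound (zmul_bound (L i l) (L j l)) (L k l)) _.
  apply: leq_trans (_ : h ^ 9 <= _)%N; last by rewrite leq_pmull.
  by rewrite (_ : h * h * h = h ^ 3)%N ?leq_pexp2l // !expnS expn0 muln1 mulnA.
have dn0 (i j k l : 'I_h) : i != l -> j != l -> k != l ->
    (v i - v l) * (v j - v l) * (v k - v l) != 0.
  by move=> il jl kl; rewrite !mulf_neq0 // subr_eq0 vI.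
have vinj (i j : 'I_h) (t : int) : v i - t = v j - t -> i = j.
  by move=> /addIr e; apply/val_inj; have := congr1 absz e; rewrite !absz_nat.
set F := [seq _ <- _ | _].
have FP a b c a' b' c' : (a, b, c, (a', b', c')) \in F ->
    [/\ quad_eval P (- v a') = (v a - v a') * (v b - v a') * (v c - v a'),
     - quad_eval P (- v a) = (v a' - v a) * (v b' - v a) * (v c' - v a),
     [&& a != a', b != a' & c != a'] & [&& a' != a, b' != a & c' != a]].
  rewrite mem_filter => /andP[/eqP <- /cubic_restP[_]] /=.
  rewrite !negb_or => /and5P[aa' ab' ac' ba' /and5P[_ _ ca' _ _]].
  rewrite !diff_quad_evalE; split => //; try ring.
    by rewrite aa' ba' ca'.
  by rewrite ![_ == a]eq_sym aa' ab' ac'.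
have uF : uniq F by rewrite filter_uniq // enum_uniq.
clearbody F.
rewrite -[h in (h * _)%N](size_enum_ord h).
apply: (@size_fibers _ _ (fun z : T => z.2.1.1)) => [z _|y1 _]; first by rewrite mem_enum.
apply: size_le_mem => -[[[a b] c] [[a' b'] c']].
rewrite mem_filter /= => /andP[/eqP <- {y1}] /FP[nE _ /and3P[aa' ba' ca'] _].
set n := quad_eval P (- v a') in nE.
have n0 : n != 0 by rewrite nE dn0.
have nle : (`|n| <= 512 * h ^ 9)%N by rewrite nE.
have dv := size_zdivisors_le n0 nle.
pose k (z : T) := (v z.1.1.1 - v a', v z.1.1.2 - v a', v z.1.2 - v a').
pose L2 := [seq (x, y) | x <- zdivisors n, y <- zdivisors n].
pose L3 := [seq (x, y) | x <- L2, y <- zdivisors n].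
clear a b c b' c' aa' ba' ca' nE.
have sL3 : (size L3 <= (2 * D) ^ 3)%N.
  by rewrite !size_allpairs !expnS expn0 muln1 mulnA; exact: (leq_mul (leq_mul dv dv) dv).
apply: leq_trans (leq_mul sL3 (leqnn _)).
apply: (@size_fibers _ _ k).
  move=> [[[a b] c] [[a1 b'] c']]; rewrite mem_filter /= => /andP[/eqP -> /FP[nE _ _ _]].
  rewrite /k /=; apply: allpairs_f; first apply: allpairs_f; apply: mem_zdivisors => //; rewrite /n nE.
  - by exists ((v b - v a') * (v c - v a')); ring.
  - by exists ((v a - v a') * (v c - v a')); ring.
  - by exists ((v a - v a') * (v b - v a')); ring.
(* Now [a'], [a], [b], [c] are fixed, and the second factorization, at [- a], bounds the choices of
   [b'] and [c']. *)
move=> u _; apply: size_le_mem => -[[[a b] c] [[a1 b'] c']].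
rewrite !mem_filter /= => /andP[/eqP <- /andP[/eqP -> /FP[_ mE _ /and3P[aa' ba' ca']]]].
set m := - quad_eval P (- v a) in mE.
have m0 : m != 0 by rewrite mE dn0.
have mle : (`|m| <= 512 * h ^ 9)%N by rewrite mE.
have dm := size_zdivisors_le m0 mle.
rewrite /k /=; clear b' c' aa' ba' ca' mE a1.
set G := [seq _ <- _ | _].
have GP z : z \in G -> [/\ z \in F, z.2.1.1 = a' & z.1 = (a, b, c)].
  case: z => [[[a2 b2] c2] [[a2' b2'] c2']]; rewrite !mem_filter /k /=.
  by move=> /andP[/eqP[/vinj -> /vinj -> /vinj ->] /andP[/eqP -> ->]].
have uG : uniq G by rewrite !filter_uniq.
pose M2 := [seq (x, y) | x <- zdivisors m, y <- zdivisors m].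
apply: leq_trans (_ : size M2 <= _)%N; last first.
  by rewrite size_allpairs !expnS expn0 muln1; exact: (leq_mul dm dm).
apply: (@size_inj_le _ _ (fun z : T => (v z.2.1.2 - v a, v z.2.2 - v a))) => //.
  move=> [x [[a1' b1'] c1']] [x' [[a2' b2'] c2']] /GP[/= _ -> ->] /GP[/= _ -> ->].
  by move=> [/vinj -> /vinj ->].
move=> [[[a2 b2] c2] [[a2' b2'] c2']] /GP[zF /= e1 [e2 e3 e4]].
move: zF; rewrite {}e1 {}e2 {}e3 {}e4 => /FP[_ mE _ _].
apply: allpairs_f; apply: mem_zdivisors => //; rewrite /m mE.
- by exists ((v a' - v a) * (v c2' - v a)); ring.
- by exists ((v a' - v a) * (v b2' - v a)); ring.
Qed.

(** With a common rational root the congruence becomes an equality of integers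
    [prod (t a_i - u) = prod (t b_i - u)]. Each choice of the [a_i] fixes the left side, whose
    divisors give the [b_i]. *)
Lemma size_rational_root (t u : int) : t != 0 ->
  (`|t| <= 6 * h ^ 2)%N -> (`|u| <= 2 * h ^ 3)%N ->
  {in cubic_rest, forall z, quad_res t u (diff_quad z) = 0} ->
  (size cubic_rest <= h ^ 3 * (2 * D) ^ 3)%N.
Proof.
move=> t0 tb ub H.
have -> : (h ^ 3 = size (enum {: 'I_h * 'I_h * 'I_h}))%N.
  by rewrite -cardE !card_prod card_ord !expnS expn0 muln1 mulnA.
apply: (@size_fibers _ _ (fun z : T => z.1)) => [z _|x _]; first exact: mem_enum.
case: x => [[a b] c].
pose n := (t * v a - u) * (t * v b - u) * (t * v c - u).
have L (i : 'I_h) : (`|(t * v i - u)%R| <= 8 * h ^ 3)%N.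
  have iL : (`|v i| <= h)%N by rewrite absz_nat ltnW.
  by apply: leq_trans (zsub_bound (zmul_bound tb iL) ub) _; clear; lia.
(* If the product is zero, a factor vanishes on each side; since [t != 0] the two variables agree,
   which [meets] excludes. The fiber is then empty. *)
have [n0|n0] := eqVneq n 0.
  rewrite (_ : [seq _ <- _ | _] = [::]) //; apply/eqP; rewrite -[_ == _]negbK -has_filter.
  apply/hasPn => -[[[a1 b1] c1] [[a' b'] c']] zS; apply/eqP => -[ea eb ec].
  have [_] := cubic_restP zS; rewrite {}ea {}eb {}ec in zS *; apply/negP/negPn.
  have := diff_quad_resE a b c a' b' c' t u; rewrite (H _ zS) mulr0 -/n n0 sub0r.
  have same i j : t * v i - u == 0 -> t * v j - u == 0 -> i == j.
    rewrite !subr_eq0 => /eqP <- /eqP/(mulfI t0) e; apply/eqP/val_inj.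
    by have := congr1 absz e; rewrite !absz_nat.
  move/esym/eqP; rewrite oppr_eq0; move/eqP: n0; rewrite /n !mulf_eq0 /meets.
  by move=> /orP[/orP[]|] /same S /orP[/orP[]|] /S ->; rewrite ?orbT.
have nle : (`|n| <= 512 * h ^ 9)%N.
  by apply: leq_trans (zmul_bound (zmul_bound (L a) (L b)) (L c)) _; clear; lia.
have dv := size_zdivisors_le n0 nle.
set F := [seq _ <- _ | _].
pose k (z : T) := (t * v z.2.1.1 - u, t * v z.2.1.2 - u, t * v z.2.2 - u).
pose L2 := [seq (x, y) | x <- zdivisors n, y <- zdivisors n].
pose L3 := [seq (x, y) | x <- L2, y <- zdivisors n].
apply: leq_trans (_ : size L3 <= _)%N; last first.
  by rewrite !size_allpairs !expnS expn0 muln1 mulnA; exact: (leq_mul (leq_mul dv dv) dv).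
have FP z : z \in F -> z.1 = (a, b, c) /\ z \in cubic_rest.
  by rewrite mem_filter => /andP[/eqP].
apply: (@size_inj_le _ _ k); first by rewrite filter_uniq // enum_uniq.
  move=> [x [[a' b'] c']] [x' [[a1' b1'] c1']] /FP[/= -> _] /FP[/= -> _] [].
  have inj (i j : 'I_h) : t * v i - u = t * v j - u -> i = j.
    by move=> /addIr/(mulfI t0) e; apply/val_inj; have := congr1 absz e; rewrite !absz_nat.
  by move=> /inj -> /inj -> /inj ->.
move=> [x [[a' b'] c']] /FP[/= -> zS]; rewrite /k /=.
have := diff_quad_resE a b c a' b' c' t u; rewrite (H _ zS) mulr0 => /esym/eqP.
rewrite subr_eq0 -/n => /eqP nE.
apply: allpairs_f; first apply: allpairs_f; apply: mem_zdivisors => //; rewrite nE.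
- by exists ((t * v b' - u) * (t * v c' - u)); ring.
- by exists ((t * v a' - u) * (t * v c' - u)); ring.
- by exists ((t * v a' - u) * (t * v b' - u)); ring.
Qed.

(** The first term counts solutions with a coincidence; the other two correspond to the alternatives
    of [quad_points], few quadratics or a common rational root. *)
Lemma energy3_interval_le : (7 * h ^ 4 <= p)%N ->
  (energy3 f f f <= 9 * (h * energy2 f f) +
     (2142 * h ^ 2 * (h * ((2 * D) ^ 3 * (2 * D) ^ 2)) + h ^ 3 * (2 * D) ^ 3))%N.
Proof.
move=> hp; rewrite /energy3 /hits -/cubic_sols -(cardID [pred z | meets z]).
apply: leq_add.
  by apply: leq_trans card_meets; rewrite subset_leq_card //; apply/fintype.subsetP => z; rewrite !inE andbC.
have -> : #|[predD cubic_sols & [pred z | meets z]]| = size cubic_rest.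
  by rewrite /cubic_rest -cardE; apply: eq_card => z; rewrite !inE andbC.
pose ss := undup [seq diff_quad z | z <- cubic_rest].
have [|||] := @quad_points p h s ss pp h0 hp; first exact: undup_uniq.
- move=> P; rewrite mem_undup => /mapP[z /cubic_restP[zS _] ->].
  by rewrite diff_quad_small diff_quad_dvd.
- move=> ssle; apply: leq_trans (leq_addr _ _).
  apply: leq_trans (leq_mul ssle (leqnn _)).
  apply: (@size_fibers _ _ diff_quad) => [z zS|P _]; last exact: size_same_diff_quad.
  by rewrite mem_undup map_f.
- move=> [t [u [t0 tb ub H]]]; apply: leq_trans (leq_addl _ _).
  apply: (@size_rational_root t u) => // z zS; apply: H.
  by rewrite mem_undup map_f.
Qed.
End CubicCongruence.

(** * Products of two elements of a short interval *)

Section QuadraticCongruence.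
Variables (p h : nat) (s : int).
Hypotheses (pp : prime p) (h0 : (0 < h)%N) (hp : (2 * h ^ 2 < p)%N).
Variable D : nat.
Hypothesis HD : forall n, (0 < n)%N -> (n <= 512 * h ^ 9)%N -> (size (divisors n) <= D)%N.
Local Notation f := (interval_fun p (h := h) s).

(** The range [[- h, h]] contains all differences of two offsets below [h]. *)
Definition centered (i : 'I_(2 * h).+1) : int := (i : nat)%:Z - h%:Z.

Definition centered_fun (i : 'I_(2 * h).+1) : 'F_p := (centered i)%:~R.

Lemma centered_le i : (`|centered i| <= h)%N.
Proof. by rewrite /centered; have := ltn_ord i; clear; move: (nat_of_ord i) => x; lia. Qed.

Lemma centered_inj : injective centered.
Proof. by move=> i j /addIr e; apply/val_inj; have := congr1 absz e; rewrite !absz_nat. Qed.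

Lemma centered_inord (i j : 'I_h) :
  centered (inord (h + i - j)) = (i : nat)%:Z - (j : nat)%:Z.
Proof.
have := ltn_ord i; have := ltn_ord j; rewrite /centered => hj hi.
by rewrite inordK; move: hj hi; clear; move: (nat_of_ord i) (nat_of_ord j) => x y; lia.
Qed.

Lemma dvdz_small (z : int) : (p%:Z %| z)%Z -> (`|z| < p)%N -> z = 0.
Proof.
move=> pz zp; apply/eqP; rewrite -absz_eq0; apply/negPn/negP; rewrite -lt0n => z0.
by have := dvdn_leq z0 pz; rewrite leqNgt zp.
Qed.

(** After cross-multiplication the two sides differ by at most [2 * h ^ 2 < p], so they agree as
    integers; the two variables of one side are fixed and those of the other are divisors of their
    product. *)
Lemma hits_centered_le :
  (hits (quot2 centered_fun) (quot2 centered_fun) <= (2 * h).+1 ^ 2 * (2 * D) ^ 2)%N.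
Proof.
rewrite /hits cardE; set S := enum _.
have SP z : z \in S ->
    [/\ centered z.1.1 * centered z.2.2 = centered z.2.1 * centered z.1.2,
      centered z.1.1 != 0 & centered z.2.2 != 0].
  rewrite mem_enum inE /quot2 /centered_fun => /andP[/eqP e ne].
  have := ne; rewrite {1}e !mulf_eq0 !invr_eq0 !negb_or => /andP[c0 d0].
  move: ne; rewrite mulf_eq0 invr_eq0 negb_or => /andP[a0 b0].
  move/eqP: e; rewrite eqr_div // -!rmorphM Fp_intr_eq // => dv.
  split.
  - apply/eqP; rewrite -subr_eq0; apply/eqP; apply: dvdz_small => //.
    apply: leq_ltn_trans hp.
    apply: leq_trans (zsub_bound (zmul_bound (centered_le _) (centered_le _))
      (zmul_bound (centered_le _) (centered_le _))) _.
    by rewrite addnn -mul2n mulnn.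
  - by apply/eqP => z0; have {}z0 : centered z.1.1 = 0 := z0; rewrite z0 mulr0z eqxx in a0.
  - by apply/eqP => z0; have {}z0 : centered z.2.2 = 0 := z0; rewrite z0 mulr0z eqxx in d0.
have -> : ((2 * h).+1 ^ 2 = size (enum {: 'I_(2 * h).+1 * 'I_(2 * h).+1}))%N.
  by rewrite -cardE card_prod card_ord.
apply: (@size_fibers _ _ (fun z => (z.1.1, z.2.2))) => [z _|u _]; first by rewrite mem_enum.
apply: size_le_mem => -[[a b] [c d]]; rewrite mem_filter => /andP[/eqP <- /SP[/= _ a0 d0]].
pose n := centered a * centered d.
have n0 : n != 0 by rewrite mulf_neq0.
have nle : (`|n| <= 512 * h ^ 9)%N.
  apply: leq_trans (zmul_bound (centered_le _) (centered_le _)) _.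
  apply: leq_trans (_ : h ^ 9 <= _)%N; last by rewrite leq_pmull.
  by rewrite mulnn leq_pexp2l.
have dv := size_zdivisors_le HD n0 nle.
apply: leq_trans (_ : size [seq (x, y) | x <- zdivisors n, y <- zdivisors n] <= _)%N; last first.
  by rewrite size_allpairs -mulnn; exact: (leq_mul dv dv).
apply: (@size_inj_le _ _ (fun z => (centered z.2.1, centered z.1.2))).
- by rewrite filter_uniq // enum_uniq.
- move=> [[a1 b1] [c1 d1]] [[a2 b2] [c2 d2]]; rewrite !mem_filter /=.
  by move=> /andP[/eqP[-> ->] _] /andP[/eqP[-> ->] _] [/centered_inj -> /centered_inj ->].
move=> [[a1 b1] [c1 d1]]; rewrite mem_filter => /andP[/eqP[ea ed] /SP[/= e _ _]].
rewrite ea ed in e; apply: allpairs_f; apply: mem_zdivisors => //; rewrite /n e.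
  by exists (centered b1); rewrite mulrC.
by exists (centered c1).
Qed.

(** Two distinct points [(f a, f b)] and [(f c, f d)] on a line through the origin have their
    difference on it too, so [f a / f b] is also a quotient of centered differences. Equal points
    account for [h ^ 2]. *)
Lemma hits_quot_interval_le :
  (hits (quot2 f) (quot2 f) <= h ^ 2 + hits (quot2 f) (quot2 centered_fun))%N.
Proof.
rewrite {1}/hits -(cardID [pred z | z.1 == z.2]); apply: leq_add.
  have -> : (h ^ 2 = #|{: 'I_h * 'I_h}|)%N by rewrite card_prod card_ord.
  apply: (@card_le_in_inj _ _ _ _ (fun z => z.1)) => //.
  by move=> [x y] [x' y'] /andP[_ /eqP /= <-] /andP[_ /eqP /= <-] ->.
pose k (z : 'I_h * 'I_h * ('I_h * 'I_h)) : 'I_h * 'I_h * ('I_(2 * h).+1 * 'I_(2 * h).+1) :=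
  (z.1, (inord (h + z.2.1 - z.1.1), inord (h + z.2.2 - z.1.2))).
apply: (@card_le_inj _ _ _ _ k).
  move=> [[a b] [c d]] [[a' b'] [c' d']] [-> ->].
  move=> /(congr1 centered); rewrite !centered_inord => /addIr e1.
  move=> /(congr1 centered); rewrite !centered_inord => /addIr e2.
  by congr (_, (_, _)); apply/val_inj; [have := congr1 absz e1|have := congr1 absz e2];
    rewrite !absz_nat.
move=> [[a b] [c d]]; rewrite !inE /k /quot2 /centered_fun /= => /andP[ne /andP[/eqP e n0]].
rewrite !centered_inord n0 andbT.
have := n0; rewrite {1}e !mulf_eq0 !invr_eq0 !negb_or => /andP[fc fd].
move: n0; rewrite mulf_eq0 invr_eq0 negb_or => /andP[fa fb].
have fB (i j : 'I_h) : ((i : nat)%:Z - (j : nat)%:Z)%:~R = f i - f j :> 'F_p.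
  by rewrite -rmorphB; congr (_%:~R); rewrite /=; ring.
have fI (i j : 'I_h) : f i = f j -> i = j.
  move=> /eqP; rewrite Fp_intr_eq // (_ : _ - _ = (i : nat)%:Z - (j : nat)%:Z); last by ring.
  move=> dv; have : (i : nat)%:Z - (j : nat)%:Z = 0.
    apply: dvdz_small => //; apply: leq_ltn_trans hp; have := ltn_ord i; have := ltn_ord j.
    by move: h0; clear; move: (nat_of_ord i) (nat_of_ord j) => x y; nia.
  by move/subr0_eq => e0; apply/val_inj; have := congr1 absz e0; rewrite !absz_nat.
rewrite !fB; move/eqP: e; rewrite eqr_div // => /eqP e.
have e' : (f c - f a) * f b = f a * (f d - f b).
  by rewrite mulrBl mulrBr e; ring.
have db : f d - f b != 0.
  apply: contraNneq ne => d0; move: e'; rewrite d0 mulr0 => /eqP.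
  rewrite mulf_eq0 (negPf fb) orbF subr_eq0 => /eqP/fI ->.
  by move/subr0_eq: d0 => /fI ->.
by rewrite eqr_div // -e' mulrC.
Qed.

Lemma energy2_interval_le :
  (energy2 f f <= 2 * h ^ 2 + (2 * h).+1 ^ 2 * (2 * D) ^ 2)%N.
Proof.
apply: leq_trans (energy2_le_hits_quot2 _ _) _.
apply: leq_trans (leq_add (leqnn _) hits_centered_le).
have e1 := hits_quot_interval_le.
have e2 := hits_sqr_le (quot2 f) (quot2 centered_fun).
move: (hits _ _) (hits _ _) (hits _ _) e1 e2 => Q R G e1 e2.
(* From [Q <= h ^ 2 + R] and [R ^ 2 <= Q * G], the mean inequality [2 * R <= Q + G] gives
   [Q <= 2 * h ^ 2 + G]. *)
have e3 := (nat_AGM2 Q G).1.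
have : (2 * R <= Q + G)%N by rewrite -leq_sqr expnMn; move: e2 e3; clear; lia.
by move: e1; clear; lia.
Qed.
End QuadraticCongruence.

(** * Powers and long intervals *)

Lemma eq_hits (F : fieldType) (X Y : finType) (f f' : X -> F) (g g' : Y -> F) :
  f =1 f' -> g =1 g' -> hits f g = hits f' g'.
Proof. by move=> ff gg; apply: eq_card => -[x y]; rewrite !inE /= ff gg. Qed.

Lemma hits_le_card (F : fieldType) (X Y : finType) (f : X -> F) (g : Y -> F) :
  (hits f g <= #|X| * #|Y|)%N.
Proof. by rewrite -card_prod max_card. Qed.

Section Powers.
Variable F : finFieldType.

Lemma hits_scale_le (X : finType) (f : X -> F) (c : F) :
  (hits (fun x => (c * f x)%R) (fun x => (c * f x)%R) <= hits f f)%N.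
Proof.
apply: subset_leq_card; apply/fintype.subsetP => z.
rewrite !inE => /andP[/eqP e1]; rewrite mulf_eq0 negb_or => /andP[c0 ->].
by rewrite andbT; apply/eqP; apply: (mulfI c0).
Qed.

(** Equal powers mean that the quotient of the two values is one of at most [|e|] roots of unity;
    for each root, Cauchy-Schwarz bounds the hits of [f] with its multiple by those of [f] with
    itself. *)
Lemma hits_exprz_le (X : finType) (f : X -> F) (e : int) : e != 0 ->
  (hits (fun x => (f x ^ e)%R) (fun x => (f x ^ e)%R) <= `|e| * hits f f)%N.
Proof.
move=> e0; rewrite {1}/hits cardE; set S := enum _.
have SP z : z \in S -> [/\ f z.1 != 0, f z.2 != 0 & f z.1 ^+ `|e| = f z.2 ^+ `|e|].
  rewrite mem_enum inE => /andP[/eqP fe n0].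
  have f1 : f z.1 != 0 by apply: contraNneq n0 => ->; rewrite exp0rz (negPf e0).
  have f2 : f z.2 != 0 by apply: contraNneq n0 => f0; rewrite fe f0 exp0rz (negPf e0).
  split => //; move: fe; case: (e) => n; rewrite ?NegzE; first by rewrite -!exprnP.
  by rewrite -!exprnN => /invr_inj.
pose L := enum [pred x : F | `|e|.-unity_root x].
have sL : (size L <= `|e|)%N.
  apply: max_unity_roots; rewrite ?absz_gt0 ?enum_uniq //.
  by apply/allP => x; rewrite mem_enum.
apply: leq_trans (leq_mul sL (leqnn _)).
apply: (@size_fibers _ _ (fun z => f z.1 / f z.2)) => [z /SP[f1 f2 fe]|x xL].
  by rewrite mem_enum inE; apply/unity_rootP; rewrite expr_div_n fe divff // expf_neq0.
apply: leq_trans (_ : hits f (fun y => (x * f y)%R) <= _)%N.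
  rewrite /hits cardE; apply: uniq_leq_size; first by rewrite filter_uniq // enum_uniq.
  move=> z; rewrite mem_filter => /andP[/eqP <- /SP[f1 f2 _]].
  by rewrite mem_enum inE f1 andbT divfK.
by apply: hits_le => //; exact: hits_scale_le.
Qed.

Lemma energy2_exprz_le (X : finType) (f : X -> F) (e : int) : e != 0 ->
  (energy2 (fun x => (f x ^ e)%R) (fun x => (f x ^ e)%R) <= `|e| * energy2 f f)%N.
Proof.
move=> e0; apply: leq_trans (hits_exprz_le (prod2 f f) e0).
have E z : prod2 (fun x => f x ^ e) (fun x => f x ^ e) z = prod2 f f z ^ e by rewrite /prod2 !expfzMl.
by rewrite /energy2 (eq_hits E E).
Qed.

Lemma energy3_exprz_le (X : finType) (f : X -> F) (e : int) : e != 0 ->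
  (energy3 (fun x => (f x ^ e)%R) (fun x => (f x ^ e)%R) (fun x => (f x ^ e)%R)
    <= `|e| * energy3 f f f)%N.
Proof.
move=> e0; apply: leq_trans (hits_exprz_le (prod3 f f f) e0).
have E z : prod3 (fun x => f x ^ e) (fun x => f x ^ e) (fun x => f x ^ e) z = prod3 f f f z ^ e by rewrite /prod3 !expfzMl.
by rewrite /energy3 (eq_hits E E).
Qed.
End Powers.

Section Subdivision.
Variables (p h l : nat) (s : int).
Local Notation I h s := (interval_fun p (h := h) s).
Local Notation m := (h %/ l.+1).+1.

Definition block (q : 'I_m) : 'I_l.+1 -> 'F_p := interval_fun p (h := l.+1) (s + ((q : nat) * l.+1)%N%:Z).

Definition quo (i : 'I_h) : 'I_m := inord (i %/ l.+1).
Definition rem (i : 'I_h) : 'I_l.+1 := inord (i %% l.+1).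

Lemma quo_rem (i : 'I_h) : (i : nat) = ((quo i : nat) * l.+1 + rem i)%N.
Proof.
rewrite !inordK ?ltn_pmod // -?divn_eq // ltnS.
by apply: leq_div2r; apply: ltnW.
Qed.

Lemma quo_rem_inj (i j : 'I_h) : quo i = quo j -> rem i = rem j -> i = j.
Proof. by move=> e1 e2; apply/val_inj; rewrite /= (quo_rem i) (quo_rem j) e1 e2. Qed.

Lemma block_rem (i : 'I_h) : interval_fun p s i = block (quo i) (rem i).
Proof. by rewrite /block /interval_fun {1}(quo_rem i); congr (_%:~R); rewrite PoszD; ring. Qed.

(** Fixing the blocks of the four variables costs [m ^ 4], and Cauchy-Schwarz bounds the resulting
    mixed energy of four blocks by [M]. The last block may overshoot the interval, which an upper
    bound allows. *)
Lemma energy2_subdivision M :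
  (forall s' : int, energy2 (I l.+1 s') (I l.+1 s') <= M)%N ->
  (energy2 (I h s) (I h s) <= m ^ 4 * M)%N.
Proof.
move=> HM; rewrite /energy2 {1}/hits cardE; set S := enum _.
pose k (z : 'I_h * 'I_h) := (quo z.1, quo z.2).
pose r (z : 'I_h * 'I_h) := (rem z.1, rem z.2).
have kr z z' : k z = k z' -> r z = r z' -> z = z'.
  by case: z z' => [a b] [a' b'] [/quo_rem_inj Ha /quo_rem_inj Hb] [/Ha -> /Hb ->].
have -> : (m ^ 4 = size (enum {: 'I_m * 'I_m * ('I_m * 'I_m)}))%N.
  by rewrite -cardE !card_prod !card_ord; ring.
apply: (@size_fibers _ _ (fun z => (k z.1, k z.2))) => [z _|u _]; first by rewrite mem_enum.
case: u => [[a b] [c d]].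
apply: leq_trans (_ : hits (prod2 (block a) (block b)) (prod2 (block c) (block d)) <= _)%N; last first.
  by apply: hits_le; apply: energy2_le; apply: HM.
rewrite /hits cardE; apply: (@size_inj_le _ _ (fun z => (r z.1, r z.2))).
- by rewrite filter_uniq // enum_uniq.
- move=> [x y] [x' y']; rewrite !mem_filter /= => /andP[/eqP[e1 e2 e3 e4] _].
  move=> /andP[/eqP[e1' e2' e3' e4'] _] [e5 e6 e7 e8].
  by congr pair; apply: kr; rewrite /k /r /=; congruence.
move=> [[x1 x2] [y1 y2]]; rewrite mem_filter /k /r /= => /andP[/eqP[<- <- <- <-]].
by rewrite !mem_enum !inE /prod2 /= !block_rem.
Qed.

Lemma energy3_subdivision M :
  (forall s' : int, energy3 (I l.+1 s') (I l.+1 s') (I l.+1 s') <= M)%N ->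
  (energy3 (I h s) (I h s) (I h s) <= m ^ 6 * M)%N.
Proof.
move=> HM; rewrite /energy3 {1}/hits cardE; set S := enum _.
pose k (z : 'I_h * 'I_h * 'I_h) := (quo z.1.1, quo z.1.2, quo z.2).
pose r (z : 'I_h * 'I_h * 'I_h) := (rem z.1.1, rem z.1.2, rem z.2).
have kr z z' : k z = k z' -> r z = r z' -> z = z'.
  case: z z' => [[a b] c] [[a' b'] c'] [/quo_rem_inj Ha /quo_rem_inj Hb /quo_rem_inj Hc].
  by move=> [/Ha -> /Hb -> /Hc ->].
have -> : (m ^ 6 = size (enum {: 'I_m * 'I_m * 'I_m * ('I_m * 'I_m * 'I_m)}))%N.
  by rewrite -cardE !card_prod !card_ord; ring.
apply: (@size_fibers _ _ (fun z => (k z.1, k z.2))) => [z _|u _]; first by rewrite mem_enum.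
case: u => [[[a b] c] [[a' b'] c']].
apply: leq_trans (_ : hits (prod3 (block a) (block b) (block c))
  (prod3 (block a') (block b') (block c')) <= _)%N; last first.
  by apply: hits_le; apply: energy3_le; apply: HM.
rewrite /hits cardE; apply: (@size_inj_le _ _ (fun z => (r z.1, r z.2))).
- by rewrite filter_uniq // enum_uniq.
- move=> [x y] [x' y']; rewrite !mem_filter /= => /andP[/eqP[e1 e2 e3 e4 e5 e6] _].
  move=> /andP[/eqP[e1' e2' e3' e4' e5' e6'] _].
  by move=> [e7 e8 e9 e10 e11 e12]; congr pair; apply: kr; rewrite /k /r /=; congruence.
move=> [[[x1 x2] x3] [[y1 y2] y3]]; rewrite mem_filter /k /r /=.
by move=> /andP[/eqP[<- <- <- <- <- <-]]; rewrite !mem_enum !inE /prod3 /= !block_rem.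
Qed.
End Subdivision.

(** * The divisor bound *)

Lemma size_divisorsE n : size (divisors n) = (\prod_(f <- prime_decomp n) f.2.+1)%N.
Proof.
rewrite unlock /divisors /=; elim: (prime_decomp n) => //= -[q a] l IH.
rewrite -{}IH.
elim: a => [|a IHa] /=; first by rewrite mul1n.
by rewrite size_merge size_cat size_map IHa [in RHS]mulSn addnC.
Qed.

(** Indeed [a + 1 <= m * (a %/ m + 1) <= m * 2 ^ (a %/ m)]; then raise to the power [m]. *)
Lemma expn_succ_le (m a : nat) : (0 < m)%N -> (a.+1 ^ m <= m ^ m * 2 ^ a)%N.
Proof.
move=> m0; apply: (@leq_trans ((m * 2 ^ (a %/ m)) ^ m)).
  rewrite leq_exp2r //; apply: (@leq_trans (m * (a %/ m).+1)%N).
    by rewrite mulnC; exact: ltn_ceil.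
  by rewrite leq_mul2l ltn_expl ?orbT.
by rewrite expnMn -expnM leq_mul2l leq_pexp2l ?orbT // leq_divM.
Qed.

(** A prime power [q ^ a] contributes [(a + 1) ^ m], which is at most [q ^ a] when [q >= 2 ^ m].
    Each of the at most [2 ^ m] smaller primes costs a factor [m ^ m]. *)
Lemma size_divisors_le (m n : nat) : (0 < m)%N -> (0 < n)%N ->
  (size (divisors n) ^ m <= (m ^ m) ^ (2 ^ m) * n)%N.
Proof.
move=> m0 n0.
have mm0 : (0 < m ^ m)%N by rewrite expn_gt0 m0.
have exp_mono a b c : (a <= b)%N -> (a ^ c <= b ^ c)%N.
  by case: c => // c ab; rewrite leq_exp2r.
have factor q a : prime q -> (a.+1 ^ m <= (m ^ m) ^ (q < 2 ^ m) * q ^ a)%N.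
  move=> pq; case: ltnP => q2; rewrite ?expn1 ?expn0 ?mul1n.
    apply: leq_trans (expn_succ_le a m0) _.
    by rewrite leq_mul2l exp_mono ?orbT // prime_gt1.
  apply: leq_trans (exp_mono _ _ a q2).
  by rewrite expnAC exp_mono // ltn_expl.
have prod_le l : all (fun f => prime f.1) l -> ((\prod_(f <- l) f.2.+1) ^ m <=
    (m ^ m) ^ (count (fun f => f.1 < 2 ^ m) l) * \prod_(f <- l) f.1 ^ f.2)%N.
  elim: l => [_|f l IH]; first by rewrite !big_nil exp1n.
  move=> /= /andP[pf /IH {}IH]; rewrite !big_cons expnMn expnD mulnACA.
  by apply: leq_mul => //; exact: factor.
rewrite size_divisorsE [X in (_ <= _ * X)%N](prod_prime_decomp n0).
apply: leq_trans (prod_le _ _) _.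
  apply/allP => f fn; have : f.1 \in primes n by apply/mapP; exists f.
  by rewrite mem_primes => /andP[].
rewrite leq_mul2r; apply/orP; right; apply: leq_pexp2l => //.
have -> : count (fun f => f.1 < 2 ^ m)%N (prime_decomp n) = count (fun q => q < 2 ^ m)%N (primes n).
  by rewrite count_map.
rewrite -size_filter -[leqRHS](size_iota 0).
apply: uniq_leq_size; first by rewrite filter_uniq // primes_uniq.
by move=> q; rewrite mem_filter mem_iota => /andP[].
Qed.

(** [D] is the maximal divisor count up to [512 * h ^ 9]; being attained, it inherits the bound for
    a single integer. *)
Lemma max_divisors (m : nat) : (0 < m)%N -> exists C, (0 < C)%N /\ forall h, (0 < h)%N ->
  exists D, [/\ (0 < D)%N, forall n, (0 < n)%N -> (n <= 512 * h ^ 9)%N -> (size (divisors n) <= D)%N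
    & (D ^ m <= C * h ^ 9)%N].
Proof.
move=> m0; exists ((m ^ m) ^ (2 ^ m) * 512)%N; split; first by rewrite muln_gt0 !expn_gt0 m0.
move=> h h0; pose F (i : 'I_(512 * h ^ 9)) := size (divisors i.+1).
have X0 : (0 < 512 * h ^ 9)%N by rewrite muln_gt0 expn_gt0 h0.
have I0 : (0 < #|'I_(512 * h ^ 9)|)%N by rewrite card_ord.
have [i iE] := @bigop.eq_bigmax _ F I0; exists (F i); split.
- by rewrite /F -has_predT; apply/hasP; exists 1%N => //; rewrite -dvdn_divisors.
- move=> [//|n] _ nle; rewrite -iE.
  exact: (bigop.leq_bigmax (F := F) (Ordinal nle)).
- apply: leq_trans (size_divisors_le m0 (ltn0Sn i)) _.
  by rewrite -mulnA leq_mul2l ltn_ord orbT.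
Qed.

Lemma threshold (P : pred nat) (h : nat) : P 1 -> ~~ P h -> (0 < h)%N ->
  exists l, [/\ (l.+1 < h)%N, P l.+1 & ~~ P l.+2].
Proof.
move=> P1; elim: h => // h IH nPh _; case: h IH nPh => [|h] IH nPh; first by rewrite P1 in nPh.
case Ph : (P h.+1); first by exists h.
by have [l [lh ? ?]] := IH (negbT Ph) isT; exists l; split => //; apply: ltnW.
Qed.

(** * Energies of intervals of arbitrary length *)

Section EnergyBounds.
Variables (p h D : nat).
Hypotheses (pp : prime p) (h0 : (0 < h)%N) (D0 : (0 < D)%N).
Hypothesis HD : forall n, (0 < n)%N -> (n <= 512 * h ^ 9)%N -> (size (divisors n) <= D)%N.
Local Notation I h s := (interval_fun p (h := h) s).

Lemma divisors_bound_mono l : (l <= h)%N ->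
  forall n, (0 < n)%N -> (n <= 512 * l ^ 9)%N -> (size (divisors n) <= D)%N.
Proof.
move=> lh n n0 nl; apply: HD => //; apply: leq_trans nl _.
by rewrite leq_mul2l leq_exp2r // lh orbT.
Qed.

Lemma D_pow_le k : (k <= 5)%N -> (D ^ k <= D ^ 5)%N.
Proof. by move=> k5; rewrite leq_pexp2l. Qed.

Lemma energy2_small_le l s : (0 < l)%N -> (l <= h)%N -> (2 * l ^ 2 < p)%N ->
  (energy2 (I l s) (I l s) <= 38 * l ^ 2 * D ^ 5)%N.
Proof.
move=> l0 lh lp; apply: leq_trans (energy2_interval_le s pp l0 lp (divisors_bound_mono lh)) _.
apply: (@leq_trans (2 * l ^ 2 * D ^ 5 + 36 * l ^ 2 * D ^ 5)%N); last by clear; lia.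
apply: leq_add; first by rewrite leq_pmulr // expn_gt0 D0.
apply: (@leq_trans ((3 * l) ^ 2 * (4 * D ^ 2))%N).
  apply: leq_mul; last by rewrite expnMn.
  by rewrite leq_exp2r //; move: l0; clear; lia.
rewrite expnMn [(9 * _ * _)%N](_ : _ = 36 * l ^ 2 * D ^ 2)%N; last by clear; lia.
by rewrite leq_mul2l D_pow_le ?orbT.
Qed.

Lemma energy3_small_le l s : (0 < l)%N -> (l <= h)%N -> (7 * l ^ 4 <= p)%N ->
  (energy3 (I l s) (I l s) (I l s) <= (69 * 1000) * l ^ 3 * D ^ 5)%N.
Proof.
move=> l0 lh lp; apply: leq_trans (energy3_interval_le s pp l0 (divisors_bound_mono lh) lp) _.
have lp2 : (2 * l ^ 2 < p)%N.
  apply: leq_trans lp; apply: (@leq_trans (7 * l ^ 2)%N).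
    by have : (0 < l ^ 2)%N; [rewrite expn_gt0 l0|clear; lia].
  by rewrite leq_mul2l leq_pexp2l.
have e2 := leq_mul (leqnn l) (energy2_small_le s l0 lh lp2).
have e3 := leq_mul (leqnn (8 * l ^ 3)%N) (@D_pow_le 3 isT).
have e4 : (2142 * l ^ 2 * (l * ((2 * D) ^ 3 * (2 * D) ^ 2)) = 2142 * 32 * l ^ 3 * D ^ 5)%N.
  by rewrite !expnMn; clear; lia.
have e5 : (l ^ 3 * (2 * D) ^ 3 = 8 * l ^ 3 * D ^ 3)%N by rewrite expnMn; clear; lia.
(* The constant covers 9 * 38 + 2142 * 32 + 8 = 68894. *)
rewrite e4 e5; move: e2 e3; clear; move: (energy2 _ _) (D ^ 5)%N (D ^ 3)%N => x y z; lia.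
Qed.

Lemma blocks_le l : (l.+1 <= h)%N -> ((h %/ l.+1).+1 * l.+1 <= 2 * h)%N.
Proof.
by move=> lh; rewrite mulSn; have := leq_divM h l.+1; move: lh; clear; move: (_ %/ _)%N => x; lia.
Qed.

(** A long interval is cut into blocks of a critical length [l.+1]: it is admissible but [l.+2] is
    not, so [p <= 2 * l.+2 ^ 2 <= 8 * l.+1 ^ 2]. By [blocks_le] the constant is 608 = 16 * 38. *)
Lemma energy2_cases s :
  (energy2 (I h s) (I h s) <= 608 * h ^ 2 * D ^ 5)%N \/
  exists l, (energy2 (I h s) (I h s) * l.+1 ^ 2 <= 608 * h ^ 4 * D ^ 5)%N /\ (p <= 8 * l.+1 ^ 2)%N.
Proof.
have [hp|ph] := ltnP (2 * h ^ 2) p.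
  left; apply: leq_trans (energy2_small_le s h0 (leqnn h) hp) _.
  by rewrite !leq_mul2r; apply/orP; right; apply/orP; right.
(* For [p = 2] even length one is not admissible; the trivial count [h ^ 4] then serves with
   [l = 0]. *)
right; have [p3|p2] := ltnP 2 p; last first.
  exists 0; split; last by apply: leq_trans p2 _.
  rewrite muln1; apply: leq_trans (hits_le_card _ _) _.
  rewrite !card_prod !card_ord (_ : h * h * (h * h) = h ^ 4)%N; last by clear; lia.
  rewrite -[leqLHS]mul1n -[leqLHS]muln1; apply: leq_mul; last by rewrite expn_gt0 D0.
  exact: leq_mul.
have [|||l [lh lp lp']] := @threshold (fun l => 2 * l ^ 2 < p)%N h => //; first by rewrite -leqNgt.
exists l; split; last first.
  move: lp'; rewrite -leqNgt => /leq_trans; apply.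
  rewrite (_ : 8 * l.+1 ^ 2 = 2 * (2 * l.+1) ^ 2)%N; last by rewrite expnMn mulnA.
  by rewrite leq_mul2l leq_exp2r //; clear; lia.
have e := energy2_subdivision h s (fun s' => energy2_small_le s' (ltn0Sn l) (ltnW lh) lp).
apply: leq_trans (leq_mul e (leqnn _)) _.
have b := blocks_le (ltnW lh); rewrite -(leq_exp2r _ _ (ltn0Sn 3)) !expnMn in b.
have := leq_mul b (leqnn (38 * D ^ 5)%N); clear.
move: (h %/ l.+1)%N => m; move: l.+1 (D ^ 5)%N => k d; lia.
Qed.

(** The same cutting with the condition [7 * l ^ 4 <= p]: 64 = 2 ^ 6 comes from the number of blocks
    and 112 = 7 * 2 ^ 4 from doubling the length. Primes below 7 use the trivial count [h ^ 6]. *)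
Lemma energy3_cases s :
  (energy3 (I h s) (I h s) (I h s) <= (64 * (69 * 1000)) * h ^ 3 * D ^ 5)%N \/
  exists l, (energy3 (I h s) (I h s) (I h s) * l.+1 ^ 3 <= (64 * (69 * 1000)) * h ^ 6 * D ^ 5)%N
    /\ (p <= 112 * l.+1 ^ 4)%N.
Proof.
have [hp|ph] := leqP (7 * h ^ 4) p.
  left; apply: leq_trans (energy3_small_le s h0 (leqnn h) hp) _.
  by rewrite !leq_mul2r; apply/orP; right; apply/orP; right.
right; have [p7|p7] := leqP 7 p; last first.
  exists 0; split; last by apply: leq_trans (ltnW p7) _.
  rewrite muln1; apply: leq_trans (hits_le_card _ _) _.
  rewrite !card_prod !card_ord (_ : h * h * h * (h * h * h) = h ^ 6)%N; last by clear; lia.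
  rewrite -[leqLHS]mul1n -[leqLHS]muln1; apply: leq_mul; last by rewrite expn_gt0 D0.
  exact: leq_mul.
have [|||l [lh lp lp']] := @threshold (fun l => 7 * l ^ 4 <= p)%N h => //; first by rewrite -ltnNge.
exists l; split; last first.
  move: lp'; rewrite -ltnNge => /ltnW/leq_trans; apply.
  rewrite (_ : 112 * l.+1 ^ 4 = 7 * (2 * l.+1) ^ 4)%N; last by rewrite expnMn mulnA.
  by rewrite leq_mul2l leq_exp2r //; clear; lia.
have e := energy3_subdivision h s (fun s' => energy3_small_le s' (ltn0Sn l) (ltnW lh) lp).
apply: leq_trans (leq_mul e (leqnn _)) _.
have b := blocks_le (ltnW lh); rewrite -(leq_exp2r _ _ (ltn0Sn 5)) !expnMn in b.
have := leq_mul b (leqnn ((69 * 1000) * D ^ 5)%N); clear.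
move: (h %/ l.+1)%N => m; move: l.+1 (D ^ 5)%N => k d; lia.
Qed.
End EnergyBounds.

(** * Energy bounds with real exponents *)

Section RealBounds.
Variable R : realType.

Lemma natr_ge1 (n : nat) : (0 < n)%N -> 1 <= n%:R :> R.
Proof. by move=> n0; rewrite ler1n. Qed.

Lemma max_divisors_powR (eps : R) : 0 < eps -> exists C : R, 0 < C /\ forall h, (0 < h)%N ->
  exists D, [/\ (0 < D)%N, forall n, (0 < n)%N -> (n <= 512 * h ^ 9)%N -> (size (divisors n) <= D)%N
    & (D ^ 5)%:R <= C * h%:R `^ eps].
Proof.
(* From [D ^ m <= C * h ^ 9] the power [D ^ 5] has exponent 45 / [m] in [h], which must not exceed
   [eps]. *)
move=> eps0; pose m := (Num.truncn (45 / eps)).+1.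
have mE : 45 / eps <= m%:R by apply/ltW/truncnS_gt.
have m0 : 0 < m%:R :> R by rewrite ltr0n.
have [C [C0 HC]] := @max_divisors m isT.
exists (C%:R `^ (5 / m%:R)); split; first by rewrite powR_gt0 ?ltr0n.
move=> h h0; have [D [D0 HD DC]] := HC h h0; exists D; split => //.
have -> : (D ^ 5)%:R = (D ^ m)%:R `^ (5 / m%:R) :> R.
  rewrite !natrX -!powR_mulrn ?ler0n // -powRrM; congr (_ `^ _).
  by rewrite mulrC divfK // gt_eqF.
apply: (@le_trans _ _ ((C * h ^ 9)%:R `^ (5 / m%:R))).
  by rewrite ge0_ler_powR ?nnegrE ?ler0n ?ler_nat // divr_ge0 // ltW.
rewrite natrM powRM ?ler0n // ler_pM2l ?powR_gt0 ?ltr0n //.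
rewrite natrX -powR_mulrn ?ler0n // -powRrM; apply: ler_powR; first exact: natr_ge1.
by rewrite mulrA -natrM ler_pdivrMr // mulrC -ler_pdivrMr.
Qed.

Lemma powR_3_4_le (p k : nat) : (0 < p)%N -> (0 < k)%N -> (p <= 112 * k ^ 4)%N ->
  (k%:R ^+ 3)^-1 <= 112 * p%:R `^ (- (3 / 4)) :> R.
Proof.
move=> p0 k0 pk; rewrite powRN.
have P0 : 0 < p%:R `^ (3 / 4) :> R by rewrite powR_gt0 ?ltr0n.
have K0 : 0 < k%:R ^+ 3 :> R by rewrite exprn_gt0 ?ltr0n.
rewrite -[leLHS]mul1r ler_pdivrMr // mulrAC ler_pdivlMr // mul1r.
apply: (@le_trans _ _ ((112 * k ^ 4)%:R `^ (3 / 4))).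
  by rewrite ge0_ler_powR ?nnegrE ?ler0n ?ler_nat // divr_ge0.
rewrite natrM powRM ?ler0n // natrX -powR_mulrn ?ler0n // -powRrM -(powR_mulrn _ (ler0n _ _)).
have -> : 4%:R * (3 / 4) = 3%:R :> R by field.
rewrite ler_pM2r ?powR_gt0 ?ltr0n // -[leRHS]powRr1 ?ler0n //.
by apply: ler_powR; [rewrite ler1n|lra].
Qed.

Local Notation I p h s := (interval_fun p (h := h) s).

(** In the second case of [energy2_cases], [p <= 8 * l.+1 ^ 2] turns the saving [l.+1 ^ 2] into the
    factor [8 / p]. *)
Lemma energy2_powR_le (eps : R) : 0 < eps -> exists C : R, 0 < C /\
  forall p h s, prime p -> (0 < h)%N ->
  (energy2 (I p h s) (I p h s))%:R <= C * h%:R `^ eps * (h%:R ^+ 2 + h%:R ^+ 4 / p%:R).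
Proof.
move=> eps0; have [C [C0 HC]] := max_divisors_powR eps0.
have [K KE] : exists K : R, K = 608%:R by eexists.
have K1 : 0 < K by rewrite KE ltr0n.
have K0 := ltW K1.
exists (K * 8 * C); split; first by rewrite !mulr_gt0 ?ltr0n.
move=> p h s pp h0; have [D [D0 HD DC]] := HC h h0.
have P0 : 0 < p%:R :> R by rewrite ltr0n prime_gt0.
have H0 : 0 < h%:R :> R by rewrite ltr0n.
have -> : K * 8 * C * h%:R `^ eps * (h%:R ^+ 2 + h%:R ^+ 4 / p%:R) =
  8 * (K * h%:R ^+ 2 * (C * h%:R `^ eps)) + 8 * (K * h%:R ^+ 4 * (C * h%:R `^ eps) / p%:R) by ring.
have X0 : 0 <= h%:R ^+ 2 :> R by rewrite exprn_ge0 // ltW.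
have Y0 : 0 <= h%:R ^+ 4 :> R by rewrite exprn_ge0 // ltW.
have Z0 : 0 <= C * h%:R `^ eps by rewrite mulr_ge0 ?powR_ge0 // ltW.
have A0 : 0 <= K * h%:R ^+ 2 * (C * h%:R `^ eps) by apply: mulr_ge0 => //; apply: mulr_ge0.
have B0 : 0 <= K * h%:R ^+ 4 * (C * h%:R `^ eps) by apply: mulr_ge0 => //; apply: mulr_ge0.
have Bp0 : 0 <= K * h%:R ^+ 4 * (C * h%:R `^ eps) / p%:R by rewrite divr_ge0 // ltW.
have [e|[l [e pl]]] := energy2_cases pp h0 D0 HD s.
  apply: le_trans (_ : K * h%:R ^+ 2 * (C * h%:R `^ eps) <= _).
    rewrite -(ler_nat R) natrM [(_ * h ^ 2)%:R]natrM natrX -KE in e.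
    by apply: le_trans e _; rewrite ler_wpM2l // mulr_ge0.
  by move: A0 Bp0; clear; lra.
have L0 : 0 < l.+1%:R ^+ 2 :> R by rewrite exprn_gt0 ?ltr0n.
rewrite -(ler_nat R) natrM natrX natrM [(_ * h ^ 4)%:R]natrM natrX -KE in e.
apply: le_trans (_ : K * h%:R ^+ 4 * (C * h%:R `^ eps) * (l.+1%:R ^+ 2)^-1 <= _).
  rewrite ler_pdivlMr //; apply: le_trans e _.
  by rewrite ler_wpM2l // mulr_ge0.
apply: le_trans (_ : K * h%:R ^+ 4 * (C * h%:R `^ eps) * (8 / p%:R) <= _).
  rewrite ler_wpM2l // -[leLHS]mul1r ler_pdivrMr // mulrAC ler_pdivlMr // mul1r.
  by rewrite -natrX -natrM ler_nat.
by move: A0 Bp0; clear; lra.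
Qed.

Lemma energy3_powR_le (eps : R) : 0 < eps -> exists C : R, 0 < C /\
  forall p h s, prime p -> (0 < h)%N ->
  (energy3 (I p h s) (I p h s) (I p h s))%:R
    <= C * h%:R `^ eps * (h%:R ^+ 3 + h%:R ^+ 6 * p%:R `^ (- (3 / 4))).
Proof.
move=> eps0; have [C [C0 HC]] := max_divisors_powR eps0.
have [K KE] : exists K : R, K = (64 * (69 * 1000))%:R by eexists.
have K1 : 0 < K by rewrite KE ltr0n !muln_gt0.
have K0 := ltW K1.
exists (K * 112 * C); split; first by rewrite !mulr_gt0 ?ltr0n.
move=> p h s pp h0; have [D [D0 HD DC]] := HC h h0.
have H0 : 0 < h%:R :> R by rewrite ltr0n.
set q := p%:R `^ _.
have q0 : 0 <= q by rewrite powR_ge0.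
have X0 : 0 <= h%:R ^+ 3 :> R by rewrite exprn_ge0 // ltW.
have Y0 : 0 <= h%:R ^+ 6 :> R by rewrite exprn_ge0 // ltW.
have Z0 : 0 <= C * h%:R `^ eps by rewrite mulr_ge0 ?powR_ge0 // ltW.
have -> : K * 112 * C * h%:R `^ eps * (h%:R ^+ 3 + h%:R ^+ 6 * q) =
  112 * (K * h%:R ^+ 3 * (C * h%:R `^ eps)) + 112 * (K * h%:R ^+ 6 * (C * h%:R `^ eps) * q) by ring.
have A0 : 0 <= K * h%:R ^+ 3 * (C * h%:R `^ eps) by apply: mulr_ge0 => //; apply: mulr_ge0.
have B0 : 0 <= K * h%:R ^+ 6 * (C * h%:R `^ eps) by apply: mulr_ge0 => //; apply: mulr_ge0.
have Bq0 : 0 <= K * h%:R ^+ 6 * (C * h%:R `^ eps) * q by rewrite mulr_ge0.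
have [e|[l [e pl]]] := energy3_cases pp h0 D0 HD s.
  apply: le_trans (_ : K * h%:R ^+ 3 * (C * h%:R `^ eps) <= _).
    rewrite -(ler_nat R) natrM [(_ * h ^ 3)%:R]natrM natrX -KE in e.
    by apply: le_trans e _; rewrite ler_wpM2l // mulr_ge0.
  by move: A0 Bq0; clear; lra.
have L0 : 0 < l.+1%:R ^+ 3 :> R by rewrite exprn_gt0 ?ltr0n.
rewrite -(ler_nat R) natrM natrX natrM [(_ * h ^ 6)%:R]natrM natrX -KE in e.
apply: le_trans (_ : K * h%:R ^+ 6 * (C * h%:R `^ eps) * (l.+1%:R ^+ 3)^-1 <= _).
  rewrite ler_pdivlMr //; apply: le_trans e _.
  by rewrite ler_wpM2l // mulr_ge0.
apply: le_trans (_ : K * h%:R ^+ 6 * (C * h%:R `^ eps) * (112 * q) <= _).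
  by rewrite ler_wpM2l // powR_3_4_le // prime_gt0.
by move: A0 Bq0; clear; lra.
Qed.
End RealBounds.

(** * Bilinear exponential sums *)

Definition fp_char (R : realType) (p : nat) (x : 'F_p) : R[i] := ep R p (x : nat)%:Z.

Section AdditiveCharacter.
Variables (R : realType) (p : nat).
Hypothesis pp : prime p.
Local Notation C := R[i].
Local Notation psi := (@fp_char R p).

Lemma ep_natE (n : nat) : ep R p n%:Z = ep R p 1 ^+ n.
Proof.
have epD a b : ep R p (a + b) = ep R p a * ep R p b.
  rewrite /ep rmorphD /= mulrDr mulrDl cosD sinD; apply/eqP.
  by rewrite eq_complex /=; apply/andP; split; apply/eqP; ring.
elim: n => [|n IH]; first by rewrite /ep mulr0 mul0r cos0 sin0.
by rewrite -addn1 PoszD epD IH exprD expr1.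
Qed.

Lemma p_neq0 : p%:R != 0 :> R.
Proof. by rewrite pnatr_eq0 -lt0n prime_gt0. Qed.

Lemma ep1_expp : ep R p 1 ^+ p = 1.
Proof.
rewrite -ep_natE /ep -mulrA divff ?p_neq0 // mulr1.
have -> : 2 * pi = pi + pi :> R by rewrite mulr_natl mulr2n.
by rewrite cosD sinD cospi sinpi; apply/eqP; rewrite eq_complex /=; apply/andP; split; apply/eqP; ring.
Qed.

(** Since [p >= 2], the angle [2 pi / p] lies in [(0, pi]], where the cosine is below 1. *)
Lemma ep1_neq1 : ep R p 1 != 1.
Proof.
rewrite /ep eq_complex /= negb_and; apply/orP; left.
rewrite mulr1 lt_eqF //.
have p2 : 2 <= p%:R :> R by rewrite ler_nat prime_gt1.
have pi0 := pi_gt0 R.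
have p0 : 0 < p%:R :> R by rewrite (lt_le_trans _ p2).
rewrite -[ltRHS]cos0 ltr_cos ?in_itv /=; first by rewrite divr_gt0 // mulr_gt0.
  by rewrite lexx ltW.
apply/andP; split; last by rewrite ler_pdivrMr // mulrC ler_pM2l.
by apply: divr_ge0; [apply: mulr_ge0 => //; apply: ltW|apply: ltW].
Qed.

Lemma psiE (x : 'F_p) : psi x = ep R p 1 ^+ x.
Proof. exact: ep_natE. Qed.

Lemma psiD (x y : 'F_p) : psi (x + y) = psi x * psi y.
Proof.
rewrite !psiE -exprD -[RHS](expr_mod _ ep1_expp); congr (_ ^+ _).
by congr modn; exact: Fp_cast.
Qed.

Lemma psi0 : psi 0 = 1.
Proof. by rewrite psiE. Qed.

Lemma psi_conj (x : 'F_p) : Num.conj (psi x) = psi (- x).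
Proof.
have n1 : psi x * (psi x)^* = 1.
  rewrite /fp_char /ep; apply/eqP; rewrite eq_complex /=; apply/andP; split; apply/eqP; last by ring.
  by rewrite mulrN opprK -!expr2 cos2Dsin2.
have psi1 : psi x * psi (- x) = 1 by rewrite -psiD subrr psi0.
have x0 : psi x != 0 by apply/eqP => x0; move/eqP: psi1; rewrite x0 mul0r eq_sym oner_eq0.
by apply: (mulfI x0); rewrite psi1; exact: n1.
Qed.

Lemma norm_psi (x : 'F_p) : `|psi x| = 1.
Proof.
by apply/eqP; rewrite -(@pexpr_eq1 _ _ 2) // normCK psi_conj -psiD subrr psi0.
Qed.

(** Orthogonality: for [a != 0] the sum is over all of ['F_p], and the shift by 1 multiplies it by
    [psi 1], which is not 1. *)
Lemma sum_psi (a : 'F_p) : \sum_t psi (t * a) = if a == 0 then p%:R else 0.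
Proof.
case: eqVneq => [->|a0].
  under eq_bigr do rewrite mulr0 psi0.
  by rewrite sumr_const card_ord Fp_cast.
rewrite (reindex_inj (mulIf (invr_neq0 a0))) /=.
under eq_bigr do rewrite divfK //.
set S := \sum_t _; have e : S = S * psi 1.
  rewrite {1}/S (reindex_inj (addIr 1)) /= mulr_suml.
  by apply: eq_bigr => t _; rewrite psiD.
have w1 : psi 1 != 1 by rewrite psiE /= modn_small ?Fp_cast ?prime_gt1 // expr1 ep1_neq1.
apply/eqP; move/eqP: e; rewrite -subr_eq0 -{1}[S]mulr1 -mulrBr mulf_eq0.
by rewrite subr_eq0 [1 == _]eq_sym (negPf w1) orbF.
Qed.
End AdditiveCharacter.

(** Used over the complex numbers, whose order is partial: nonnegative terms are real, which makes
    the squares in Lagrange's identity nonnegative. *)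
Lemma sqr_sum_mul_ler (F : numDomainType) (I : finType) (P : pred I) (a b : I -> F) :
  (forall i, 0 <= a i) -> (forall i, 0 <= b i) ->
  (\sum_(i | P i) a i * b i) ^+ 2 <= (\sum_(i | P i) a i ^+ 2) * (\sum_(i | P i) b i ^+ 2).
Proof.
move=> a0 b0; rewrite -(@ler_pMn2r _ 2) // expr2 !big_distrlr /=.
have -> : (\sum_(i | P i) \sum_(j | P j) a i ^+ 2 * b j ^+ 2) *+ 2 =
    \sum_(i | P i) \sum_(j | P j) (a i ^+ 2 * b j ^+ 2 + a j ^+ 2 * b i ^+ 2).
  transitivity (\sum_(i | P i) \sum_(j | P j) a i ^+ 2 * b j ^+ 2 +
    \sum_(i | P i) \sum_(j | P j) a j ^+ 2 * b i ^+ 2).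
    by rewrite [X in _ = _ + X]exchange_big /= mulr2n.
  by rewrite -big_split; apply: eq_bigr => i _; rewrite -big_split.
rewrite -sumrMnl; apply: ler_sum => i _; rewrite -sumrMnl; apply: ler_sum => j _.
rewrite -subr_ge0 (_ : _ - _ = (a i * b j - a j * b i) ^+ 2); last by ring.
by rewrite real_exprn_even_ge0 // realB // ger0_real // mulr_ge0.
Qed.

Section Bilinear.
Variables (R : realType) (p : nat).
Hypothesis pp : prime p.
Local Notation C := R[i].
Local Notation psi := (@fp_char R p).

Lemma norm_fiber_sum (A : finType) (u : A -> 'F_p) (al : A -> C) t :
  (forall a, `|al a| <= 1) ->
  `|\sum_(a | u a == t) al a| <= #|[pred a | u a == t]|%:R.
Proof.
move=> al1; apply: le_trans (ler_norm_sum _ _ _) _.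
rewrite -sum1_card natr_sum; apply: ler_sum => a _; exact: al1.
Qed.

(** Expanding the square, the sum over [t] vanishes by orthogonality unless [v b = v c], when it
    equals [p]. *)
Lemma second_moment (B : finType) (v : B -> 'F_p) (be : B -> C) (la : 'F_p) :
  la != 0 -> (forall b, `|be b| <= 1) ->
  \sum_t `|\sum_(b | v b != 0) be b * psi (la * (t * v b))| ^+ 2 <= (p * hits v v)%:R.
Proof.
move=> la0 be1.
rewrite -[leLHS]ger0_norm; last by apply: sumr_ge0 => t _; rewrite exprn_ge0.
have -> : \sum_t `|\sum_(b | v b != 0) be b * psi (la * (t * v b))| ^+ 2 =
    \sum_(b | v b != 0) \sum_(c | v c != 0) be b * Num.conj (be c) * (if v b == v c then p%:R else 0).
  under eq_bigr => t _.
    rewrite normCK rmorph_sum big_distrlr /=.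
    over.
  rewrite exchange_big; apply: eq_bigr => b _; rewrite exchange_big; apply: eq_bigr => c _.
  have -> : (v b == v c) = (la * (v b - v c) == 0) by rewrite mulf_eq0 (negPf la0) subr_eq0.
  rewrite -(sum_psi R pp) mulr_sumr; apply: eq_bigr => t _.
  rewrite rmorphM /= (psi_conj R pp) mulrACA -(psiD R pp); congr (_ * psi _).
  by ring.
apply: le_trans (_ : \sum_(b | v b != 0) \sum_(c | v c != 0) (if v b == v c then p%:R else 0 : C) <= _).
  apply: le_trans (ler_norm_sum _ _ _) _; apply: ler_sum => b _.
  apply: le_trans (ler_norm_sum _ _ _) _; apply: ler_sum => c _.
  rewrite !normrM norm_conjC; case: ifP => _; last by rewrite normr0 mulr0.
  by rewrite normr_nat ler_piMl // mulr_ile1.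
rewrite pair_big_dep /= -big_mkcondr /= natrM /hits -sum1_card natr_sum mulr_sumr.
rewrite le_eqVlt; apply/orP; left; apply/eqP; apply: eq_big => [[b c]|[b c] _]; last by rewrite mulr1.
rewrite !inE /=; case: (eqVneq (v b) (v c)) => [->|_]; last by rewrite andbF.
by rewrite andbT andbb.
Qed.

(** Grouping by the value [t] of [u] writes the sum as [U t * W t] summed over [t]. Cauchy-Schwarz
    applies: [|U t|] is at most a fiber count, whose squares sum to [hits u u], and [W] is handled
    by [second_moment]. *)
Lemma bilinear_sum_le (A B : finType) (u : A -> 'F_p) (v : B -> 'F_p)
  (al : A -> C) (be : B -> C) (la : 'F_p) :
  la != 0 -> (forall a, `|al a| <= 1) -> (forall b, `|be b| <= 1) ->
  `|\sum_(z : A * B | (u z.1 != 0) && (v z.2 != 0))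
     al z.1 * be z.2 * psi (la * (u z.1 * v z.2))| ^+ 2 <= (p * hits u u * hits v v)%:R.
Proof.
move=> la0 al1 be1.
pose U t := \sum_(a | u a == t) al a.
pose W t := \sum_(b | v b != 0) be b * psi (la * (t * v b)).
have -> : \sum_(z : A * B | (u z.1 != 0) && (v z.2 != 0))
     al z.1 * be z.2 * psi (la * (u z.1 * v z.2)) = \sum_(t | t != 0) U t * W t.
  rewrite -(pair_big_dep (fun a => u a != 0) (fun _ b => v b != 0)
    (fun a b => al a * be b * psi (la * (u a * v b)))) /=.
  rewrite (partition_big u (fun t => t != 0)) //=; apply: eq_bigr => t t0.
  rewrite mulr_suml; apply: eq_big => [a|a /andP[_ /eqP <-]].
    by have [->|_] := eqVneq (u a) t; rewrite ?t0 ?andbF ?andbT.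
  by rewrite /W mulr_sumr; apply: eq_bigr => b _; rewrite [RHS]mulrA.
apply: le_trans (_ : (\sum_(t | t != 0) `|U t| * `|W t|) ^+ 2 <= _).
  rewrite lerXn2r ?nnegrE ?normr_ge0 //.
    by apply: sumr_ge0 => t _; rewrite mulr_ge0.
  by apply: le_trans (ler_norm_sum _ _ _) _; apply: ler_sum => t _; rewrite normrM.
apply: le_trans (sqr_sum_mul_ler _ _ _) _ => //.
rewrite -mulnA mulnCA natrM; apply: ler_pM.
- by apply: sumr_ge0 => t _; rewrite exprn_ge0.
- by apply: sumr_ge0 => t _; rewrite exprn_ge0.
- rewrite hitsE natr_sum; apply: ler_sum => t _.
  rewrite natrM -expr2; apply: lerXn2r; rewrite ?nnegrE ?normr_ge0 ?ler0n //.
  exact: norm_fiber_sum.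
(* The nonnegative term at [t = 0] is added to obtain a complete sum. *)
- apply: le_trans (second_moment v la0 be1).
  rewrite [leRHS](bigID (fun t => t != 0)) /= lerDl.
  by apply: sumr_ge0 => t _; rewrite exprn_ge0.
Qed.
End Bilinear.

(** * Energies of blocks of variables indexed by functions *)

Section FfunHits.
Variables (F : finFieldType) (X : finType).

Definition prod_ffun (n : nat) (G : 'I_n -> X -> F) (a : {ffun 'I_n -> X}) : F :=
  \prod_(j < n) G j (a j).

Lemma hits_prod2_le (G : 'I_2 -> X -> F) M : (forall j, energy2 (G j) (G j) <= M)%N ->
  (hits (prod_ffun G) (prod_ffun G) <= M)%N.
Proof.
move=> GM; pose o1 : 'I_2 := lift ord0 ord0.
apply: leq_trans (energy2_le (GM ord0) (GM o1)).
have E (a : {ffun 'I_2 -> X}) : prod_ffun G a = prod2 (G ord0) (G o1) (a ord0, a o1).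
  by rewrite /prod_ffun !big_ord_recl big_ord0 mulr1.
apply: (@card_le_inj _ _ _ _ (fun z : {ffun 'I_2 -> X} * {ffun 'I_2 -> X} => ((z.1 ord0, z.1 o1), (z.2 ord0, z.2 o1)))).
  have inj (a b : {ffun 'I_2 -> X}) : a ord0 = b ord0 -> a o1 = b o1 -> a = b.
    by move=> e0 e1; apply/ffunP => -[[|[|//]] hj];
      [rewrite (_ : Ordinal hj = ord0)|rewrite (_ : Ordinal hj = o1)] => //; apply/val_inj.
  by move=> [a b] [a' b'] [/inj ea /ea -> /inj eb /eb ->].
by move=> [a b]; rewrite !inE /= !E.
Qed.

Lemma hits_prod3_le (G : 'I_3 -> X -> F) M : (forall j, energy3 (G j) (G j) (G j) <= M)%N ->
  (hits (prod_ffun G) (prod_ffun G) <= M)%N.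
Proof.
move=> GM; pose o1 : 'I_3 := lift ord0 ord0; pose o2 : 'I_3 := lift ord0 (lift ord0 ord0).
apply: leq_trans (energy3_le (GM ord0) (GM o1) (GM o2)).
have E (a : {ffun 'I_3 -> X}) :
    prod_ffun G a = prod3 (G ord0) (G o1) (G o2) (a ord0, a o1, a o2).
  by rewrite /prod_ffun !big_ord_recl big_ord0 mulr1 mulrA.
apply: (@card_le_inj _ _ _ _ (fun z : {ffun 'I_3 -> X} * {ffun 'I_3 -> X} => ((z.1 ord0, z.1 o1, z.1 o2), (z.2 ord0, z.2 o1, z.2 o2)))).
  have inj (a b : {ffun 'I_3 -> X}) : a ord0 = b ord0 -> a o1 = b o1 -> a o2 = b o2 -> a = b.
    by move=> e0 e1 e2; apply/ffunP => -[[|[|[|//]]] hj];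
      [rewrite (_ : Ordinal hj = ord0)|rewrite (_ : Ordinal hj = o1)|
       rewrite (_ : Ordinal hj = o2)] => //; apply/val_inj.
  by move=> [a b] [a' b'] [/inj ea /ea{}ea /ea -> /inj eb /eb{}eb /eb ->].
by move=> [a b]; rewrite !inE /= !E.
Qed.

(** The first variable on each side is fixed, at the cost of [#|X| ^ 2]; it only scales the product
    of the other three, and scaling does not increase the hits. *)
Lemma hits_prod4_le (G : 'I_4 -> X -> F) M : (forall j, energy3 (G j) (G j) (G j) <= M)%N ->
  (hits (prod_ffun G) (prod_ffun G) <= #|X| ^ 2 * M)%N.
Proof.
move=> GM; pose G' (j : 'I_3) := G (lift ord0 j).
pose tl (a : {ffun 'I_4 -> X}) : {ffun 'I_3 -> X} := [ffun j => a (lift ord0 j)].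
have E (a : {ffun 'I_4 -> X}) : prod_ffun G a = G ord0 (a ord0) * prod_ffun G' (tl a).
  by rewrite /prod_ffun big_ord_recl; congr (_ * _); apply: eq_bigr => j _; rewrite ffunE.
have inj (a b : {ffun 'I_4 -> X}) : a ord0 = b ord0 -> tl a = tl b -> a = b.
  move=> e0 /ffunP e1; apply/ffunP => j; case: (unliftP ord0 j) => [j' ->|-> //].
  by have := e1 j'; rewrite !ffunE.
rewrite {1}/hits cardE.
have -> : (#|X| ^ 2 = size (enum {: X * X}))%N by rewrite -cardE card_prod mulnn.
apply: (@size_fibers _ _ (fun z : {ffun 'I_4 -> X} * {ffun 'I_4 -> X} => (z.1 ord0, z.2 ord0))) => [z _|[x y] _]; first by rewrite mem_enum.
have G'M := hits_prod3_le (fun j => GM (lift ord0 j)).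
apply: leq_trans (_ : hits (fun a => (G ord0 x * prod_ffun G' a)%R)
    (fun a => (G ord0 y * prod_ffun G' a)%R) <= _)%N; last first.
  by apply: hits_le; apply: leq_trans (hits_scale_le _ _) G'M.
rewrite {1}/hits [leqRHS]cardE; apply: (@size_inj_le _ _ (fun z : {ffun 'I_4 -> X} * {ffun 'I_4 -> X} => (tl z.1, tl z.2))).
- by rewrite filter_uniq // enum_uniq.
- move=> [a b] [a' b']; rewrite !mem_filter /= => /andP[/eqP[e1 e2] _] /andP[/eqP[e3 e4] _].
  by move=> /= [ta tb]; congr (_, _); apply: inj => //; congruence.
move=> [a b]; rewrite mem_filter !mem_enum !inE /= => /andP[/eqP[<- <-]].
by rewrite !E.
Qed.
End FfunHits.

(** * The weighted sum as a bilinear form *)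

Section WeightedSum.
Variable R : realType.
Local Notation C := R[i].
Local Notation psi p := (@fp_char R p).

Definition monomial_factor (p h n : nat) (e k : 'I_n -> int) (j : 'I_n) (x : 'I_h) : 'F_p :=
  interval_fun p (k j + 1) x ^ e j.

Definition weight (h n : nat) (rho : 'I_n -> R -> C) (k : 'I_n -> int) (j : 'I_n) (x : 'I_h) : C :=
  rho j (k j + 1 + (x : nat)%:Z)%:~R.

(** As no exponent is zero, [x ^ e] vanishes in ['F_p] exactly when [x] does, so the condition on
    the variables becomes one on the monomial. *)
Lemma weighted_sumE (p n h : nat) (la : int) (rho : 'I_n -> R -> C) (e k : 'I_n -> int) :
  prime p -> (forall j, e j != 0) ->
  weighted_sum p h la rho e k =
  \sum_(i : {ffun 'I_n -> 'I_h} | prod_ffun (@monomial_factor p h n e k) i != 0)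
    (\prod_(j < n) weight rho k j (i j)) *
      psi p (la%:~R * prod_ffun (@monomial_factor p h n e k) i).
Proof.
move=> pp e0; apply: eq_bigl => i; congr (~~ _).
rewrite -Fp_intr_eq0 // rmorph_prod /=.
apply/idP/idP => /eqP/eqP; rewrite !prodf_seq_eq0 => /hasP[j jI /= j0].
  apply/hasP; exists j => //=; rewrite /monomial_factor /interval_fun.
  by rewrite (eqP j0) exp0rz (negPf (e0 j)).
apply/hasP; exists j => //=; move: j0; rewrite /monomial_factor.
by rewrite expfz_eq0 => /andP[_].
Qed.

Lemma norm_weight_prod_le (h n : nat) (rho : 'I_n -> R -> C) (k : 'I_n -> int)
    (m : nat) (s : 'I_m -> 'I_n) (i : {ffun 'I_m -> 'I_h}) :
  (forall j x, `|rho j x| <= 1) -> `|\prod_(j < m) weight rho k (s j) (i j)| <= 1.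
Proof.
move=> r1; by rewrite normr_prod; apply: prodr_ile1 => j; rewrite normr_ge0 r1.
Qed.

Lemma weighted_sum_split (p m n h : nat) (la : int) (rho : 'I_(m + n) -> R -> C)
    (e k : 'I_(m + n) -> int) :
  prime p -> (forall j, e j != 0) -> ~~ (p%:Z %| la)%Z ->
  (forall j x, `|rho j x| <= 1) ->
  `|weighted_sum p h la rho e k| ^+ 2 <= (p *
    hits (prod_ffun (fun j => @monomial_factor p h _ e k (lshift n j))) (prod_ffun (fun j => @monomial_factor p h _ e k (lshift n j))) *
    hits (prod_ffun (fun j => @monomial_factor p h _ e k (rshift m j))) (prod_ffun (fun j => @monomial_factor p h _ e k (rshift m j))))%:R.
Proof.
move=> pp e0 la0 r1; rewrite weighted_sumE //.
set u := (prod_ffun (fun j => @monomial_factor p h _ e k (lshift n j))); set v := (prod_ffun (fun j => @monomial_factor p h _ e k (rshift m j))).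
(* Concatenation of the two blocks of variables, a bijection along which the sum is reindexed. *)
pose glue (z : {ffun 'I_m -> 'I_h} * {ffun 'I_n -> 'I_h}) : {ffun 'I_(m + n) -> 'I_h} :=
  [ffun j => match fintype.split j with inl a => z.1 a | inr b => z.2 b end].
have glueL z j : glue z (lshift n j) = z.1 j.
  by rewrite ffunE -[lshift n j]/(unsplit (inl j)) unsplitK.
have glueR z j : glue z (rshift m j) = z.2 j.
  by rewrite ffunE -[rshift m j]/(unsplit (inr j)) unsplitK.
have glue_bij : bijective glue.
  exists (fun i : {ffun 'I_(m + n) -> 'I_h} => ([ffun j => i (lshift n j)], [ffun j => i (rshift m j)])).
    move=> [a b]; congr (_, _); apply/ffunP => j; rewrite ffunE; [exact: (glueL (a, b))|exact: (glueR (a, b))].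
  move=> i; apply/ffunP => j; case: (fintype.splitP j) => x jx.
    by rewrite (_ : j = lshift n x) ?glueL ?ffunE //; apply/val_inj.
  by rewrite (_ : j = rshift m x) ?glueR ?ffunE //; apply/val_inj.
have prodE z : prod_ffun (@monomial_factor p h _ e k) (glue z) = u z.1 * v z.2.
  rewrite /prod_ffun big_split_ord /=; congr (_ * _); apply: eq_bigr => j _.
    by rewrite glueL.
  by rewrite glueR.
rewrite (reindex glue) /=; last exact: onW_bij.
have la0' : la%:~R != 0 :> 'F_p by rewrite Fp_intr_eq0.
have := @bilinear_sum_le R p pp _ _ u v
  (fun a => \prod_(j < m) weight rho k (lshift n j) (a j))
  (fun b => \prod_(j < n) weight rho k (rshift m j) (b j)) _ la0'
  (fun a => norm_weight_prod_le k (@lshift m n) a r1) (fun b => norm_weight_prod_le k (@rshift m n) b r1).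
congr (`|_| ^+ 2 <= _); apply: eq_big => [z|z _]; first by rewrite prodE mulf_eq0 negb_or.
rewrite prodE; congr (_ * _); rewrite big_split_ord /=.
by congr (_ * _); apply: eq_bigr => j _; rewrite ?glueL ?glueR.
Qed.

Lemma weighted_sum_trivial (p n h : nat) (la : int) (rho : 'I_n -> R -> C) (e k : 'I_n -> int) :
  prime p -> (forall j, e j != 0) -> (forall j x, `|rho j x| <= 1) ->
  `|weighted_sum p h la rho e k| <= (h ^ n)%:R.
Proof.
move=> pp e0 r1; rewrite weighted_sumE //.
apply: le_trans (ler_norm_sum _ _ _) _.
apply: (@le_trans _ _ (\sum_(i : {ffun 'I_n -> 'I_h} |
    prod_ffun (@monomial_factor p h n e k) i != 0) 1)).
  apply: ler_sum => i _; rewrite normrM norm_psi // mulr1.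
  exact: (norm_weight_prod_le k id i r1).
rewrite sumr_const ler_nat; apply: leq_trans (max_card _) _.
by rewrite card_ffun !card_ord.
Qed.

Lemma norm_le_of_sqr (z : C) (N : nat) (B : R) :
  `|z| ^+ 2 <= N%:R -> N%:R <= B ^+ 2 -> 0 <= B -> `|z| <= B%:C.
Proof.
move=> zN NB B0; rewrite -ler_sqr ?nnegrE ?normr_ge0 ?ler0c //.
apply: le_trans zN _; rewrite -rmorphXn -(rmorph_nat (real_complex R)).
by rewrite lecR.
Qed.
End WeightedSum.

(** * Uniform energies of the factors, and the bounds as monomials *)

Section FinalBounds.
Variable R : realType.

Definition exponent_size (n : nat) (e : 'I_n -> int) : nat := (\sum_j `|e j|)%N.

Lemma leq_exponent_size n (e : 'I_n -> int) j : (`|e j| <= exponent_size e)%N.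
Proof. by rewrite /exponent_size (bigD1 j) //= leq_addr. Qed.

Lemma natr_bigmax_le (I : finType) (f : I -> nat) (B : R) : 0 <= B ->
  (forall i, (f i)%:R <= B) -> (\max_i f i)%N%:R <= B.
Proof.
move=> B0 fB; elim/big_ind: _ => // x y xB yB.
by rewrite /maxn; case: ifP.
Qed.

Lemma factor_energy2_le (eps : R) (n : nat) (e : 'I_n -> int) : 0 < eps -> (forall j, e j != 0) ->
  exists K : R, 0 < K /\ forall p h k, prime p -> (0 < h)%N -> exists M : nat,
    (forall j, energy2 (@monomial_factor p h n e k j) (@monomial_factor p h n e k j) <= M)%N /\
    M%:R <= K * h%:R `^ eps * (h%:R ^+ 2 + h%:R ^+ 4 / p%:R).
Proof.
move=> eps0 e0; have [C [C0 HC]] := energy2_powR_le eps0.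
(* The successor makes the constant positive for every [n], including the empty family. *)
exists ((exponent_size e).+1%:R * C); split; first by rewrite mulr_gt0 // ltr0n.
move=> p h k pp h0.
pose E j := energy2 (interval_fun p (h := h) (k j + 1)) (interval_fun p (h := h) (k j + 1)).
exists (exponent_size e * \max_j E j)%N.
split=> [j|].
  apply: leq_trans (energy2_exprz_le _ (e0 j)) _; apply: leq_mul; first exact: leq_exponent_size.
  exact: (bigop.leq_bigmax (F := E) j).
have B0 : 0 <= C * h%:R `^ eps * (h%:R ^+ 2 + h%:R ^+ 4 / p%:R).
  by rewrite !mulr_ge0 ?powR_ge0 ?addr_ge0 ?divr_ge0 ?exprn_ge0 ?ler0n // ltW.
set Z := (_ + _) in B0 *; have -> : (exponent_size e).+1%:R * C * h%:R `^ eps * Z =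
  (exponent_size e).+1%:R * (C * h%:R `^ eps * Z) by rewrite !mulrA.
rewrite natrM; apply: ler_pM; rewrite ?ler0n ?ler_nat //.
by apply: natr_bigmax_le => // j; exact: HC.
Qed.

Lemma factor_energy3_le (eps : R) (n : nat) (e : 'I_n -> int) : 0 < eps -> (forall j, e j != 0) ->
  exists K : R, 0 < K /\ forall p h k, prime p -> (0 < h)%N -> exists M : nat,
    (forall j, energy3 (@monomial_factor p h n e k j) (@monomial_factor p h n e k j)
       (@monomial_factor p h n e k j) <= M)%N /\
    M%:R <= K * h%:R `^ eps * (h%:R ^+ 3 + h%:R ^+ 6 * p%:R `^ (- (3 / 4))).
Proof.
move=> eps0 e0; have [C [C0 HC]] := energy3_powR_le eps0.
exists ((exponent_size e).+1%:R * C); split; first by rewrite mulr_gt0 // ltr0n.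
move=> p h k pp h0.
pose E j := energy3 (interval_fun p (h := h) (k j + 1)) (interval_fun p (h := h) (k j + 1)) (interval_fun p (h := h) (k j + 1)).
exists (exponent_size e * \max_j E j)%N.
split=> [j|].
  apply: leq_trans (energy3_exprz_le _ (e0 j)) _; apply: leq_mul; first exact: leq_exponent_size.
  exact: (bigop.leq_bigmax (F := E) j).
have B0 : 0 <= C * h%:R `^ eps * (h%:R ^+ 3 + h%:R ^+ 6 * p%:R `^ (- (3 / 4))).
  by rewrite !mulr_ge0 ?powR_ge0 ?addr_ge0 ?mulr_ge0 ?powR_ge0 ?exprn_ge0 ?ler0n // ltW.
set Z := (_ + _) in B0 *; have -> : (exponent_size e).+1%:R * C * h%:R `^ eps * Z =
  (exponent_size e).+1%:R * (C * h%:R `^ eps * Z) by rewrite !mulrA.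
rewrite natrM; apply: ler_pM; rewrite ?ler0n ?ler_nat //.
by apply: natr_bigmax_le => // j; exact: HC.
Qed.

Lemma sum_bound_ge0 n h p : 0 <= sum_bound R n h p.
Proof.
by case: n => [|[|[|[|[|[|[|[|]]]]]]]] //=; rewrite ?addr_ge0 ?mulr_ge0 ?powR_ge0.
Qed.

(* [q = p ^ (1/8)] and [g = h ^ (1/2)] turn every power in the bounds into a monomial. *)
Lemma powR_eighth (p k : nat) (a : R) : a = k%:R / 8 -> p%:R `^ a = (p%:R `^ (1 / 8)) ^+ k.
Proof. by move=> ->; rewrite -powR_mulrn ?powR_ge0 // -powRrM; congr (_ `^ _); field. Qed.

Lemma powR_eighthN (p k : nat) (a : R) : a = k%:R / 8 ->
  p%:R `^ (- a) = (p%:R `^ (1 / 8)) ^- k.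
Proof. by move=> aE; rewrite powRN (powR_eighth p aE). Qed.

Lemma powR_half (h k : nat) (a : R) : a = k%:R / 2 -> h%:R `^ a = (h%:R `^ (1 / 2)) ^+ k.
Proof. by move=> ->; rewrite -powR_mulrn ?powR_ge0 // -powRrM; congr (_ `^ _); field. Qed.

Lemma powR_eighth_exp8 (p : nat) : (0 < p)%N -> (p%:R `^ (1 / 8)) ^+ 8 = p%:R :> R.
Proof. by move=> p0; rewrite -(powR_eighth p (a := 1)) ?powRr1 ?ler0n //; field. Qed.

Lemma powR_half_exp2 (h : nat) : (0 < h)%N -> (h%:R `^ (1 / 2)) ^+ 2 = h%:R :> R.
Proof. by move=> h0; rewrite -(powR_half h (a := 1)) ?powRr1 ?ler0n //; field. Qed.

Lemma sum_boundE (h p : nat) (g := h%:R `^ (1 / 2) : R) (q := p%:R `^ (1 / 8) : R) :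
  [/\ sum_bound R 4 h p = g ^+ 4 * q ^+ 4 + g ^+ 8 * q ^- 4,
      sum_bound R 5 h p = g ^+ 5 * q ^+ 4 + g ^+ 8 * q + g ^+ 10 * q ^- 3,
      sum_bound R 6 h p = g ^+ 6 * q ^+ 4 + g ^+ 12 * q ^- 2
    & sum_bound R 7 h p = g ^+ 11 * q ^+ 2 + g ^+ 14 * q ^- 1].
Proof.
have hE (a : R) (m : nat) : a = m%:R / 2 -> h%:R `^ a = g ^+ m by exact: powR_half.
have pE (a : R) (m : nat) : a = m%:R / 8 -> p%:R `^ a = q ^+ m by exact: powR_eighth.
have pN (a : R) (m : nat) : a = m%:R / 8 -> p%:R `^ (- a) = q ^- m by exact: powR_eighthN.
have h2 : h%:R `^ 2 = g ^+ 4 by apply: hE; lra.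
have h4 : h%:R `^ 4 = g ^+ 8 by apply: hE; lra.
have h52 : h%:R `^ (5 / 2) = g ^+ 5 by apply: hE; lra.
have h5 : h%:R `^ 5 = g ^+ 10 by apply: hE; lra.
have h3 : h%:R `^ 3 = g ^+ 6 by apply: hE; lra.
have h6 : h%:R `^ 6 = g ^+ 12 by apply: hE; lra.
have h112 : h%:R `^ (11 / 2) = g ^+ 11 by apply: hE; lra.
have h7 : h%:R `^ 7 = g ^+ 14 by apply: hE; lra.
have p12 : p%:R `^ (1 / 2) = q ^+ 4 by apply: pE; lra.
have p14 : p%:R `^ (1 / 4) = q ^+ 2 by apply: pE; lra.
have n12 : p%:R `^ (- (1 / 2)) = q ^- 4 by apply: pN; lra.
have n38 : p%:R `^ (- (3 / 8)) = q ^- 3 by apply: pN; lra.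
have n14 : p%:R `^ (- (1 / 4)) = q ^- 2 by apply: pN; lra.
have n18 : p%:R `^ (- (1 / 8)) = q ^- 1 by apply: pN; lra.
split; rewrite /sum_bound.
- by rewrite h2 h4 p12 n12.
- by rewrite h52 h4 h5 p12 n38.
- by rewrite h3 h6 p12 n14.
- by rewrite h112 h7 p14 n18.
Qed.
End FinalBounds.

(** * Combining the energies for each number of variables *)

Section Assembly.
Variable R : realType.

Lemma mul_energy_le (P M1 M2 A X Y S : R) : 0 <= P -> 0 <= M1 -> 0 <= M2 ->
  M1 <= A * X -> M2 <= A * Y -> P * X * Y <= S ^+ 2 -> P * M1 * M2 <= (A * S) ^+ 2.
Proof.
move=> P0 M10 M20 X1 Y1 XY.
have -> : P * M1 * M2 = P * (M1 * M2) by rewrite mulrA.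
apply: (@le_trans _ _ (P * ((A * X) * (A * Y)))).
  by apply: ler_wpM2l => //; apply: ler_pM.
have -> : P * (A * X * (A * Y)) = A ^+ 2 * (P * X * Y) by ring.
by rewrite exprMn; apply: ler_wpM2l => //; rewrite sqr_ge0.
Qed.

(** The left side has four terms. Three are the squares of the terms on the right; the fourth,
    [g ^+ 14], is absorbed by the cross term [2 * g ^+ 15 * q] of the first and last. *)
Lemma energy_mix_le (g q : R) : 1 <= g -> 1 <= q ->
  q ^+ 8 * (g ^+ 4 + g ^+ 8 / q ^+ 8) * (g ^+ 6 + g ^+ 12 * q ^- 6) <=
  (g ^+ 5 * q ^+ 4 + g ^+ 8 * q + g ^+ 10 * q ^- 3) ^+ 2.
Proof.
move=> g1 q1; have q0 : q != 0 by rewrite gt_eqF // (lt_le_trans ltr01).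
have -> : q ^+ 8 * (g ^+ 4 + g ^+ 8 / q ^+ 8) * (g ^+ 6 + g ^+ 12 * q ^- 6) =
  g ^+ 10 * q ^+ 8 + g ^+ 16 * q ^+ 2 + g ^+ 14 + g ^+ 20 * q ^- 6 by field.
have -> : (g ^+ 5 * q ^+ 4 + g ^+ 8 * q + g ^+ 10 * q ^- 3) ^+ 2 =
  g ^+ 10 * q ^+ 8 + g ^+ 16 * q ^+ 2 + g ^+ 20 * q ^- 6 +
  (g ^+ 14 * (g * q) + (g ^+ 15 * q + 2 * (g ^+ 13 * q ^+ 5) + 2 * (g ^+ 18 * q ^- 2))) by field.
have g0 : 0 <= g by apply: le_trans g1.
have q0' : 0 <= q by apply: le_trans q1.
have e1 : g ^+ 14 <= g ^+ 14 * (g * q).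
  by rewrite ler_peMr ?exprn_ge0 // -[1]mulr1; apply: ler_pM.
have e2 : 0 <= g ^+ 15 * q + 2 * (g ^+ 13 * q ^+ 5) + 2 * (g ^+ 18 * q ^- 2).
  by rewrite !addr_ge0 // ?mulr_ge0 ?exprn_ge0 // invr_ge0 exprn_ge0.
move: e1 e2; lra.
Qed.

(** The assumption [q ^+ 2 <= g ^+ 3] turns [g ^+ 8 * q ^+ 4] into [g ^+ 11 * q ^+ 2]; the other
    term only loses a factor [q ^- 1]. *)
Lemma seven_le (g q : R) : 1 <= g -> 1 <= q -> q ^+ 2 <= g ^+ 3 ->
  q ^+ 4 * g ^+ 2 * (g ^+ 6 + g ^+ 12 * q ^- 6) <= g ^+ 11 * q ^+ 2 + g ^+ 14 * q ^- 1.
Proof.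
move=> g1 q1 qg; have q0 : q != 0 by rewrite gt_eqF // (lt_le_trans ltr01).
have g0 : 0 <= g by apply: le_trans g1.
have q0' : 0 <= q by apply: le_trans q1.
have -> : q ^+ 4 * g ^+ 2 * (g ^+ 6 + g ^+ 12 * q ^- 6) =
  g ^+ 8 * q ^+ 2 * q ^+ 2 + g ^+ 14 * q ^- 1 * q ^- 1 by field.
have -> : g ^+ 11 * q ^+ 2 = g ^+ 8 * q ^+ 2 * g ^+ 3 by ring.
apply: lerD; first by apply: ler_wpM2l => //; rewrite mulr_ge0 ?exprn_ge0.
apply: ler_piMr; first by rewrite mulr_ge0 ?invr_ge0 ?exprn_ge0.
by rewrite expr1 invf_le1 // lt_neqAle eq_sym q0.
Qed.

Lemma powR_ge1 (a x : R) : 1 <= a -> 0 <= x -> 1 <= a `^ x.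
Proof. by move=> a1 x0; rewrite -[leLHS](powRr0 a); apply: ler_powR. Qed.
End Assembly.

Theorem theorem5 (R : realType) (n : nat) (hn : n \in [:: 4; 5; 6; 7]%N)
    (e : 'I_n -> int) (he : \prod_(j < n) e j != 0) (eps : R) (heps : 0 < eps) :
  exists C : R, 0 < C /\
    forall (p h : nat) (k : 'I_n -> int) (rho : 'I_n -> R -> R[i]) (lambda : int),
      prime p -> (0 < h)%N -> (h <= p)%N ->
      (forall (j : 'I_n) (x : R), `|rho j x| <= 1) ->
      gcdz lambda p%:Z = 1 ->
      `|weighted_sum p h lambda rho e k|
        <= (C * h%:R `^ eps * sum_bound R n h p)%:C.
Proof.
have e0 j : e j != 0 by move/prodf_neq0: he; apply.
have [K2 [K2_gt0 HK2]] := factor_energy2_le heps e0.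
have [K3 [K3_gt0 HK3]] := factor_energy3_le heps e0.
(* One constant for all four cases: it dominates both energy constants, and the summand 1 serves the
   trivial bound. *)
exists (K2 + K3 + 1); split; first by rewrite !addr_gt0.
move=> p h k rho la pp h0 _ r1 cop.
have la0 : ~~ (p%:Z %| la)%Z.
  apply/negP => pla; have : (p%:Z %| gcdz la p%:Z)%Z by rewrite dvdz_gcd pla dvdzz.
  rewrite cop dvdzE /= dvdn1 => /eqP p1.
  by move: pp; rewrite p1.
have p0 := prime_gt0 pp.
have [M2 [HM2 M2le]] := HK2 p h k pp h0.
have [M3 [HM3 M3le]] := HK3 p h k pp h0.
have [S4 S5 S6 S7] := @sum_boundE R h p.
have hg := powR_half_exp2 R h0; have pq := powR_eighth_exp8 R p0.
have qN : p%:R `^ (- (3 / 4)) = (p%:R `^ (1 / 8)) ^- 6 :> R by apply: powR_eighthN; lra.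
have g1 : 1 <= h%:R `^ (1 / 2) :> R by apply: powR_ge1; rewrite ?ler1n ?divr_ge0.
have q1 : 1 <= p%:R `^ (1 / 8) :> R by apply: powR_ge1; rewrite ?ler1n ?divr_ge0.
have H1 : 1 <= h%:R `^ eps :> R by apply: powR_ge1; rewrite ?ler1n // ltW.
(* From here on [h = g ^+ 2] and [p = q ^+ 8], so the inequalities involve integer powers of [g] and
   [q] only. *)
move: (h%:R `^ (1 / 2)) (p%:R `^ (1 / 8)) (h%:R `^ eps) hg pq qN g1 q1 H1 S4 S5 S6 S7 M2le M3le.
move=> g q H hg pq qN g1 q1 H1 S4 S5 S6 S7 M2le M3le.
have q0 : q != 0 by rewrite gt_eqF // (lt_le_trans ltr01).
have g0 : 0 <= g by apply: le_trans g1.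
have q0' : 0 <= q by apply: le_trans q1.
have H0 : 0 <= H by apply: le_trans H1.
pose A := (K2 + K3 + 1) * H.
have A1 : 1 <= A by rewrite -[1]mulr1; apply: ler_pM => //; rewrite lerDr addr_ge0 // ltW.
have A0 : 0 <= A by apply: le_trans A1.
have qN0 m : 0 <= q ^- m by rewrite invr_ge0 exprn_ge0.
have {}M2le : M2%:R <= A * (g ^+ 4 + g ^+ 8 / q ^+ 8).
  rewrite -hg -pq -!exprM in M2le; apply: le_trans M2le _; apply: ler_wpM2r.
    by rewrite addr_ge0 ?mulr_ge0 ?exprn_ge0.
  by rewrite ler_wpM2r // -addrA lerDl addr_ge0 // ltW.
have {}M3le : M3%:R <= A * (g ^+ 6 + g ^+ 12 * q ^- 6).
  rewrite qN -hg -!exprM in M3le; apply: le_trans M3le _; apply: ler_wpM2r.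
    by rewrite addr_ge0 ?mulr_ge0 ?exprn_ge0.
  by rewrite ler_wpM2r // (addrC K2) -addrA lerDl addr_ge0 // ltW.
have pR : p%:R = q ^+ 8 by [].
have M20 : 0 <= M2%:R :> R by [].
have M30 : 0 <= M3%:R :> R by [].
rewrite -/A; clear HK2 HK3.
move: hn; rewrite !inE => /or4P[] /eqP nE; subst n.
(* Blocks 2 + 2: [p] times the square of the bound for products of two is a perfect square. *)
- have := @weighted_sum_split R p 2 2 h la rho e k pp e0 la0 r1.
  have hu := hits_prod2_le (fun j => HM2 (lshift 2 j)); have hv := hits_prod2_le (fun j => HM2 (rshift 2 j)).
  move: (hits _ _) (hits _ _) hu hv => u v hu hv uv.
  apply: (norm_le_of_sqr (N := p * M2 * M2)).
  + by apply: le_trans uv _; rewrite ler_nat !leq_mul.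
  + rewrite !natrM pR S4; apply: (mul_energy_le _ _ _ M2le M2le); rewrite ?exprn_ge0 //.
    by rewrite le_eqVlt; apply/orP; left; apply/eqP; field.
  + by rewrite mulr_ge0 ?sum_bound_ge0.
(* Blocks 2 + 3, whose energies differ; the product is compared with a square by [energy_mix_le]. *)
- have := @weighted_sum_split R p 2 3 h la rho e k pp e0 la0 r1.
  have hu := hits_prod2_le (fun j => HM2 (lshift 3 j)); have hv := hits_prod3_le (fun j => HM3 (rshift 2 j)).
  move: (hits _ _) (hits _ _) hu hv => u v hu hv uv.
  apply: (norm_le_of_sqr (N := p * M2 * M3)).
  + by apply: le_trans uv _; rewrite ler_nat !leq_mul.
  + rewrite !natrM pR S5; apply: (mul_energy_le _ _ _ M2le M3le); rewrite ?exprn_ge0 //.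
    exact: energy_mix_le.
  + by rewrite mulr_ge0 ?sum_bound_ge0.
(* Blocks 3 + 3, again an exact square. *)
- have := @weighted_sum_split R p 3 3 h la rho e k pp e0 la0 r1.
  have hu := hits_prod3_le (fun j => HM3 (lshift 3 j)); have hv := hits_prod3_le (fun j => HM3 (rshift 3 j)).
  move: (hits _ _) (hits _ _) hu hv => u v hu hv uv.
  apply: (norm_le_of_sqr (N := p * M3 * M3)).
  + by apply: le_trans uv _; rewrite ler_nat !leq_mul.
  + rewrite !natrM pR S6; apply: (mul_energy_le _ _ _ M3le M3le); rewrite ?exprn_ge0 //.
    by rewrite le_eqVlt; apply/orP; left; apply/eqP; field.
  + by rewrite mulr_ge0 ?sum_bound_ge0.
(* When [q ^+ 2 > g ^+ 3], that is [h < p ^ (1/6)], the trivial bound [h ^ 7 = g ^+ 14] is below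
   [g ^+ 11 * q ^+ 2]. *)
have [qg|gq] := leP (q ^+ 2) (g ^+ 3); last first.
  apply: le_trans (weighted_sum_trivial h la k pp e0 r1) _.
  rewrite -(rmorph_nat (real_complex R)) lecR natrX -hg S7.
  apply: (@le_trans _ _ (g ^+ 11 * q ^+ 2)).
    by rewrite -exprM -[(2 * 7)%N]/(11 + 3)%N exprD ler_wpM2l ?exprn_ge0 // ltW.
  apply: (@le_trans _ _ (g ^+ 11 * q ^+ 2 + g ^+ 14 * q ^- 1)).
    by rewrite lerDl mulr_ge0 ?exprn_ge0.
  by rewrite ler_peMl // addr_ge0 ?mulr_ge0 ?exprn_ge0.
(* Blocks 3 + 4, the larger one costing the factor [h ^ 2], which is itself a square. *)
have := @weighted_sum_split R p 3 4 h la rho e k pp e0 la0 r1.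
have hu := hits_prod3_le (fun j => HM3 (lshift 4 j)); have hv := hits_prod4_le (fun j => HM3 (rshift 3 j)).
rewrite card_ord in hv.
move: (hits _ _) (hits _ _) hu hv => u v hu hv uv.
apply: (norm_le_of_sqr (N := p * M3 * (h ^ 2 * M3))).
- by apply: le_trans uv _; rewrite ler_nat !leq_mul.
- apply: (@le_trans _ _ ((A * (q ^+ 4 * g ^+ 2 * (g ^+ 6 + g ^+ 12 * q ^- 6))) ^+ 2)).
    rewrite natrM [(p * _)%:R]natrM pR.
    apply: (mul_energy_le (Y := g ^+ 4 * (g ^+ 6 + g ^+ 12 * q ^- 6)) _ _ _ M3le) => //; rewrite ?exprn_ge0 //.
      rewrite natrM natrX -hg -exprM mulrCA; apply: ler_wpM2l => //; exact: exprn_ge0.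
    by rewrite le_eqVlt; apply/orP; left; apply/eqP; field.
  apply: lerXn2r; rewrite ?nnegrE.
  + apply: mulr_ge0 => //; apply: mulr_ge0; first by apply: mulr_ge0; apply: exprn_ge0.
    by apply: addr_ge0; [apply: exprn_ge0|apply: mulr_ge0 => //; apply: exprn_ge0].
  + by apply: mulr_ge0 => //; apply: sum_bound_ge0.
  + by apply: ler_wpM2l => //; rewrite S7; exact: seven_le.
- by rewrite mulr_ge0 ?sum_bound_ge0.
Qed.
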